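(* Let $m=(m_n)_{n\ge1}$ be a weight. The following statements are equivalent. (1) $m$ is FdB. (2) $E^m$ is composition closed: if $g,h\in E^m$, then also $g\circ h\in E^m$ (wherever the composition is defined). (3) $E^m$ is inversion closed: if $g$ is a local diffeomorphism in $E^m$, then its local inverse $g^{-1}$ is also in $E^m$.
   Context: A weight is a sequence $m=(m_n)_{n\ge1}$ of positive reals. Put $M_n=n!\,m_n$, $M_0=1$, $\mu_n=M_n/M_{n-1}$. Standing assumption: $m$ is weakly log-convex, i.e. $0<\mu_1\le\mu_2\le\cdots$, and $M_n^{1/n}\to\infty$. A smooth map $f$ from an open subset of some $\mathbb R^s$ into some finite-dimensional real (or complex) space is of class $E^m$ (written $f\in E^m$) if every point of its domain has a neighbourhood $U$ and a number $r>0$ such that $\sup_{x\in U}\sup_{n\ge1}\frac{1}{n!}\frac{\|D^nf(x)\|}{m_n}r^n<\infty$. Dimensions are arbitrary; a composition $g\circ h$ is considered whenever it is well defined (range of $h$ in the domain of $g$). $m$ is FdB (Faà di Bruno) if there is $\lambda\ge1$ such that for all $r\ge1$ and all integers $k_1,\dots,k_r\ge1$, $m_r\,m_{k_1}\cdots m_{k_r}\le\lambda^{k}m_k$ with $k=k_1+\cdots+k_r$. *)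

(* Defs.v *)
From HB Require Import structures.
From mathcomp Require Export all_boot all_order all_algebra.
From mathcomp Require Export all_classical all_reals all_analysis.
Export numFieldNormedType.Exports.
Export Order.TTheory GRing.Theory Num.Theory.

Set Implicit Arguments.
Unset Strict Implicit.
Unset Printing Implicit Defensive.

Local Open Scope classical_set_scope.
Local Open Scope ring_scope.

Section Weights.
Variable R : realType.
(* A sequence (m_n)_{n >= 1} is encoded as [m : nat -> R]; [m 0] never occurs:
   [bigM] returns 1 at 0, and every other occurrence of
   [m n] is guarded by [1 <= n]. *)
Implicit Type m : nat -> R.

Definition bigM m (n : nat) : R := if n is 0 then 1 else n`!%:R * m n.

Definition mu m (n : nat) : R := bigM m n / bigM m n.-1.

Definition weight m : Prop :=
  [/\ forall n, (1 <= n)%N -> 0 < m n,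
      0 < mu m 1,
      forall n, (1 <= n)%N -> mu m n <= mu m n.+1 &
      bigM m n `^ (n%:R^-1) @[n --> \oo] --> +oo].

Definition FdB m : Prop :=
  exists2 lambda : R, 1 <= lambda &
    forall (r : nat) (k : 'I_r -> nat),
      (1 <= r)%N -> (forall i, (1 <= k i)%N) ->
      m r * \prod_(i < r) m (k i)
        <= lambda ^+ (\sum_(i < r) k i)%N * m (\sum_(i < r) k i)%N.

End Weights.

Section Maps.
Variables (R : realType) (V W : normedModType R).
Implicit Types (f : V -> W) (U : set V) (x : V).

(* [iter_diff [:: v1; ...; vn] f x] is D^n f(x)(v1, ..., vn): the n-th Frechet
   derivative, uncurried, so that D^n f(x)(v1, ..., vn) is the differential at
   x, applied to v1, of y |-> D^(n-1) f(y)(v2, ..., vn). *)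
Fixpoint iter_diff (vs : seq V) f x : W :=
  if vs is v :: vs' then 'd (iter_diff vs' f) x v else f x.

(* For V finite-dimensional, differentiability of D^n f as a map into n-linear
   maps amounts to differentiability of D^n f(.)(v1, ..., vn) for all vi.
   Maps are total functions of which only the values on the open set U matter. *)
Definition smooth U f : Prop :=
  forall (vs : seq V) x, U x -> differentiable (iter_diff vs f) x.

(* The operator norm ||D^n f(x)||; a supremum in \bar R, so that finiteness is
   never a matter of convention. *)
Definition diff_norm (n : nat) f x : \bar R :=
  ereal_sup [set `|iter_diff v f x|%:E
            | v in [set v : n.-tuple V | forall i, `|tnth v i| <= 1]].

Definition classE (m : nat -> R) U f : Prop :=
  [/\ open U,
      smooth U f &
      forall x0, U x0 -> exists (A : set V) (r : R),
        [/\ nbhs x0 A, A `<=` U, 0 < r &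
          (ereal_sup
             [set (n`!%:R^-1)%:E * (diff_norm n f x * ((m n)^-1)%:E)
                    * (r ^+ n)%:E
             | x in A & n in [set n : nat | (1 <= n)%N]] < +oo)%E]].

End Maps.

Definition finite_dim (R : realType) (W : normedModType R) : Prop :=
  exists (n : nat) (b : 'I_n -> W),
    forall w, exists c : 'I_n -> R, w = \sum_(i < n) c i *: b i.

(* [g] is real-smooth, so complex target spaces are covered by viewing them as
   real normed spaces; the norm on a finite-dimensional target is immaterial. *)
Definition composition_closed (R : realType) (m : nat -> R) : Prop :=
  forall (a b : nat) (W : normedModType R), finite_dim W ->
  forall (U : set 'rV[R]_a) (V : set 'rV[R]_b)
         (h : 'rV[R]_a -> 'rV[R]_b) (g : 'rV[R]_b -> W),
    classE m V g -> classE m U h -> h @` U `<=` V ->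
    classE m U (g \o h).

Section Diffeomorphisms.
Variables (R : realType) (s : nat).
Implicit Types (U V : set 'rV[R]_s) (g k : 'rV[R]_s -> 'rV[R]_s).

Definition diffeo_with_inverse U V g k : Prop :=
  [/\ open U /\ open V,
      smooth U g /\ smooth V k,
      g @` U = V &
      forall x, U x -> k (g x) = x].

Definition local_diffeo U g : Prop :=
  forall x, U x -> exists U' V' k,
    [/\ U' x, U' `<=` U & diffeo_with_inverse U' V' g k].

End Diffeomorphisms.

(* The local inverses of [g] are the inverses of all its restrictions to open
   sets U' that are diffeomorphisms of U' onto an open set V'. *)
Definition inversion_closed (R : realType) (m : nat -> R) : Prop :=
  forall (s : nat) (U : set 'rV[R]_s) (g : 'rV[R]_s -> 'rV[R]_s),
    classE m U g -> local_diffeo U g ->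
    forall U' V' k, U' `<=` U -> diffeo_with_inverse U' V' g k ->
      classE m V' k.

(* Main.v *)
From HB Require Import structures.
Require Import Defs.
From mathcomp Require Import ring lra zify.

(* For fixed n put beta = m_n^(1/(n-1)). When m is FdB, m_k is at most
   C^k beta^(k-1) for all k <= n, so that up to order n every map of class E^m
   is majorized by a geometric series of ratio proportional to beta, with constants
   independent of n. Compositions and inverses of such maps are then controlled by the
   elementary majorant method, and beta^(n-1) = m_n gives back the E^m estimate.

   Conversely, the sine series psi = \sum M_n (2 mu_n)^(-n) sin (2 mu_n x) is of class
   E^m and |psi^(j)(0)| >= M_j for odd j, with alternating signs. All the terms in
   Faa di Bruno's formula for (psi o psi)^(n)(0) have the same sign, so that
   psi o psi in E^m forces m_s m_(k_1) ... m_(k_s) <= C^n m_n for odd s, k_i.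
   Since the roots (M_(n+1)/M_1)^(1/n) increase, this implies that
   m_(n+1)^(1/n) is almost increasing, hence FdB. For inversion, psi o psi appears
   as a component of the inverse of the shear
   (x, y, z) |-> (x, y - psi x, z - psi y). *)

Set Implicit Arguments.
Unset Strict Implicit.
Unset Printing Implicit Defensive.

Local Open Scope classical_set_scope.
Local Open Scope ring_scope.

(** * Iterated differentials *)

Section Differentials.
Variable R : realType.
Implicit Types V W : normedModType R.

(** The equivalences pass through [geometric_majorant]: it yields all three properties, and each of
    them, FdB itself included, leads back to it through [odd_growth]. The majorants have to depend
    on n, since the Taylor coefficients of a map of class E^m may outgrow every geometric sequence;
    a bound valid up to order n, with constants that do not see n, is enough for the n-th
    derivative. For the converse, working with real sine series has a price and a benefit: the even
    derivatives vanish at 0, so that only odd block sizes can be detected, but the signs of the odd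
    ones multiply ([trigD]), so that nothing cancels. Writing the sizes as T+1 and r+1 makes the
    bookkeeping additive: T+1 blocks, q of size r+1 and the others of size 1, fill T+qr+1. The shear
    is triangular, hence has an explicit global inverse. *)

Lemma is_diff_near0 V W (h : V -> W) x :
  (\near x, h x = 0) -> is_diff x h (0 : V -> W).
Proof.
move=> h0; have hx0 : h x = 0 by exact: nbhs_singleton h0.
have E : h \o shift x = cst (h x) + (\0 : {linear V -> W}) +o_ 0 id.
  apply/eqaddoP => _/posnumP[e]; near=> y.
  have -> : (h \o shift x - (cst (h x) + \0)) y = h (y + x) - (h x + 0) by [].
  rewrite hx0 addr0 subr0 (_ : h (y + x) = 0) ?normr0 ?mulr_ge0//.
  by near: y; have := h0; rewrite (near_shift 0 x)/= subr0.
have c0 : continuous (\0 : {linear V -> W}) by move=> y; exact: cvg_cst.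
by split; [apply/diff_locallyP; rewrite (diff_unique c0 E)|rewrite (diff_unique c0 E)].
Unshelve. all: by end_near. Qed.

Lemma is_diff_near V W (f g df : V -> W) x :
  (\near x, f x = g x) -> is_diff x f df -> is_diff x g df.
Proof.
move=> fg fx; have -> : g = f + (g - f) by apply/funext => y; rewrite !fctE subrKC.
have gf0 : is_diff x (g - f) (0 : V -> W).
  by apply: is_diff_near0; apply: filterS fg => y fgy; rewrite !fctE fgy subrr.
by rewrite -(addr0 df); exact: is_diffD.
Qed.

Lemma is_diff_linear V W (l : {linear V -> W}) x :
  continuous l -> is_diff x l l.
Proof. by move=> lc; split; [exact: linear_differentiable|exact: diff_lin]. Qed.

Lemma scaler_is_bilinear W :
  bilinear_for
    (GRing.Scale.Law.clone _ _ *:%R _) (GRing.Scale.Law.clone _ _ *:%R _)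
    (@GRing.scale R W : R^o -> W -> W).
Proof.
split=> [u'|u] a x y /=.
- by rewrite scalerDl scalerA.
- by rewrite scalerDr !scalerA mulrC.
Qed.

Lemma is_diffZf V W (u du : V -> R) (w dw : V -> W) x :
  is_diff x u du -> is_diff x w dw ->
  is_diff x (fun y => u y *: w y) (fun v => u x *: dw v + du v *: w x).
Proof.
move=> hu hw.
pose B := bilinear_isBilinear.Build R R^o W W _ _ (@GRing.scale R W) (scaler_is_bilinear W).
pose sc : {bilinear R^o -> W -> W} := HB.pack (@GRing.scale R W) B.
have cs : continuous (fun p : R^o * W => sc p.1 p.2).
  by move=> p; exact: scale_continuous.
have d p : is_diff p (fun p : R^o * W => sc p.1 p.2) (fun q => sc p.1 q.2 + sc q.1 p.2).
  by split; [exact: differentiable_bilin|exact: diff_bilin].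
have -> : (fun y => u y *: w y) = (fun p : R^o * W => sc p.1 p.2) \o (fun y => (u y, w y)) by [].
by apply: is_diff_eq.
Qed.

End Differentials.

Section IteratedDifferentials.
Variable R : realType.
Implicit Types (V W : normedModType R) (n : nat).

(** The last direction is differentiated first, so peeling the list from the right moves one
    differentiation into the function; the inductions below generalize over the function
    accordingly. *)
Lemma iter_diff_rcons V W vs v (f : V -> W) :
  iter_diff (rcons vs v) f = iter_diff vs (fun x => 'd f x v).
Proof. by elim: vs => //= u vs ->. Qed.

(** The grading makes induction on the order possible. Order [n] means n+1 times differentiable,
    whence the bound [n.+1] on the lists in the formulas below. *)
Definition smooth_upto V W n (U : set V) (f : V -> W) : Prop :=
  forall vs x, (size vs <= n)%N -> U x -> differentiable (iter_diff vs f) x.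

Lemma smoothP V W (U : set V) (f : V -> W) :
  smooth U f <-> forall n, smooth_upto n U f.
Proof. by split=> [+ n vs x _|/(_ (size _) _ _ (leqnn _))]; exact. Qed.

Lemma smooth_uptoW V W n p (U : set V) (f : V -> W) :
  (p <= n)%N -> smooth_upto n U f -> smooth_upto p U f.
Proof. by move=> pn fn vs x /leq_trans/(_ pn); exact: fn. Qed.

Lemma smooth_upto0 V W (U : set V) (f : V -> W) :
  smooth_upto 0 U f <-> forall x, U x -> differentiable f x.
Proof.
split=> [fU x Ux|fU vs x]; first exact: (fU [::]).
by rewrite leqn0 => /nilP ->; exact: fU.
Qed.

Lemma smooth_uptoS V W n (U : set V) (f : V -> W) :
  smooth_upto n.+1 U f <-> (forall x, U x -> differentiable f x) /\
    forall v, smooth_upto n U (fun x => 'd f x v).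
Proof.
split=> [fU|[f0 fU] vs x].
  split=> [x Ux|v vs x vsn Ux]; first exact: (fU [::]).
  by rewrite -iter_diff_rcons; apply: fU => //; rewrite size_rcons.
case/lastP: vs => [_|vs v]; first exact: f0.
by rewrite size_rcons iter_diff_rcons => ? ?; exact: fU.
Qed.

(** Any family [F] that starts with [f] and is stable under differentiation computes the iterated
    differentials: [U] is open, so agreement on [U] carries over to differentials. Closed formulas
    for sums, linear images and affine maps all come from it. *)
Lemma iter_diff_unique V W n (U : set V) (F : seq V -> V -> W) f :
  open U -> (forall x, U x -> f x = F [::] x) ->
  (forall vs x, (size vs <= n)%N -> U x -> is_diff x (F vs) (fun v => F (v :: vs) x)) ->
  smooth_upto n U f /\
  forall vs x, (size vs <= n.+1)%N -> U x -> iter_diff vs f x = F vs x.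
Proof.
move=> oU f0 dF.
have D vs x : (forall y, U y -> iter_diff vs f y = F vs y) ->
    (size vs <= n)%N -> U x -> is_diff x (iter_diff vs f) (fun v => F (v :: vs) x).
  move=> E vsn Ux; apply: is_diff_near (dF _ _ vsn Ux).
  by have := open_nbhs_nbhs (conj oU Ux); apply: filterS => y /E.
have E vs x : (size vs <= n.+1)%N -> U x -> iter_diff vs f x = F vs x.
  elim: vs x => [|v vs IH] x /=; first by move=> _; exact: f0.
  rewrite ltnS => vsn Ux.
  by have [_ ->] := D vs x (fun y => IH y (leqW vsn)) vsn Ux.
by split=> // vs x vsn Ux; have [] := D vs x (fun y => E vs y (leqW vsn)) vsn Ux.
Qed.

Lemma is_diff_iter_diff V W n (U : set V) (f : V -> W) vs x :
  smooth_upto n U f -> (size vs <= n)%N -> U x ->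
  is_diff x (iter_diff vs f) (fun v => iter_diff (v :: vs) f x).
Proof. by move=> fU vsn Ux; apply: differentiableP; exact: fU. Qed.

Lemma eq_smooth_upto V W n (U : set V) (f g : V -> W) :
  open U -> (forall x, U x -> f x = g x) -> smooth_upto n U f ->
  smooth_upto n U g /\
  forall vs x, (size vs <= n.+1)%N -> U x -> iter_diff vs g x = iter_diff vs f x.
Proof.
move=> oU fg fU; apply: iter_diff_unique => // [x /fg //|vs x vsn Ux].
exact: (is_diff_iter_diff fU vsn Ux).
Qed.

Lemma smooth_upto_add V W n (U : set V) (f g : V -> W) :
  open U -> smooth_upto n U f -> smooth_upto n U g ->
  smooth_upto n U (fun x => f x + g x) /\
  forall vs x, (size vs <= n.+1)%N -> U x ->
    iter_diff vs (fun x => f x + g x) x = iter_diff vs f x + iter_diff vs g x.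
Proof.
move=> oU fU gU.
apply: (@iter_diff_unique _ _ _ _ (fun vs x => iter_diff vs f x + iter_diff vs g x)) => // vs x vsn Ux.
exact: is_diffD (is_diff_iter_diff fU vsn Ux) (is_diff_iter_diff gU vsn Ux).
Qed.

Lemma smooth_upto_linear V W W' n (U : set V) (f : V -> W) (l : {linear W -> W'}) :
  open U -> continuous l -> smooth_upto n U f ->
  smooth_upto n U (fun x => l (f x)) /\
  forall vs x, (size vs <= n.+1)%N -> U x ->
    iter_diff vs (fun x => l (f x)) x = l (iter_diff vs f x).
Proof.
move=> oU lc fU.
apply: (@iter_diff_unique _ _ _ _ (fun vs x => l (iter_diff vs f x))) => // vs x vsn Ux.
exact: is_diff_comp (is_diff_iter_diff fU vsn Ux) (is_diff_linear _ lc).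
Qed.

Lemma smooth_upto_cst V W n (U : set V) (c : W) :
  open U -> smooth_upto n U (fun=> c : W) /\
  forall vs x, (size vs <= n.+1)%N -> U x ->
    iter_diff vs (fun=> c : W) x = if vs is [::] then c else 0.
Proof.
move=> oU.
apply: (@iter_diff_unique _ _ _ _ (fun vs x => if vs is [::] then c else 0)) => // -[|v vs] x _ _;
  exact: is_diff_cst.
Qed.

Lemma smooth_upto_sum V W n (U : set V) (I : Type) (r : seq I) (f : I -> V -> W) :
  open U -> (forall i, smooth_upto n U (f i)) ->
  smooth_upto n U (fun x => \sum_(i <- r) f i x) /\
  forall vs x, (size vs <= n.+1)%N -> U x ->
    iter_diff vs (fun x => \sum_(i <- r) f i x) x = \sum_(i <- r) iter_diff vs (f i) x.
Proof.
move=> oU fU; elim: r => [|i r [IH1 IH2]].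
  have [h1 h2] := @smooth_upto_cst V W n U 0 oU.
  under eq_fun do rewrite big_nil; split=> // vs x vsn Ux.
  by rewrite h2// big_nil; case: vs {vsn}.
have [h1 h2] := smooth_upto_add oU (fU i) IH1.
under eq_fun do rewrite big_cons; split=> // vs x vsn Ux.
by rewrite h2// big_cons IH2.
Qed.

Lemma smooth_upto_scale V W n (U : set V) (u : V -> R) (w : V -> W) :
  open U -> smooth_upto n U u -> smooth_upto n U w ->
  smooth_upto n U (fun x => u x *: w x).
Proof.
move=> oU; elim: n u w => [|n IH] u w.
  move=> /smooth_upto0 uU /smooth_upto0 wU; apply/smooth_upto0 => x Ux.
  have du := differentiableP (uU _ Ux); have dw := differentiableP (wU _ Ux).
  by case: (is_diffZf du dw).
move=> uS wS; have := uS; have := wS.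
move=> /smooth_uptoS [w0 w1] /smooth_uptoS [u0 u1].
have d x : U x -> is_diff x (fun y => u y *: w y) (fun v => u x *: 'd w x v + 'd u x v *: w x).
  by move=> Ux; apply: is_diffZf; apply: differentiableP; [exact: u0|exact: w0].
apply/smooth_uptoS; split=> [x /d[]//|v].
have nn := leqnSn n; have un := smooth_uptoW nn uS; have wn := smooth_uptoW nn wS.
have [h _] := smooth_upto_add oU (IH _ _ un (w1 v)) (IH _ _ (u1 v) wn).
apply: (eq_smooth_upto oU _ h).1 => x Ux.
by have [_ ->] := d x Ux.
Qed.

Definition row_coord n (l : 'I_n) (u : 'rV[R]_n) : R := u 0 l.

Fact row_coord_is_linear n (l : 'I_n) : linear (row_coord l).
Proof. by move=> a u v; rewrite /row_coord !mxE. Qed.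

HB.instance Definition _ n (l : 'I_n) :=
  GRing.isLinear.Build R 'rV[R]_n R _ (row_coord l) (row_coord_is_linear l).

Lemma continuous_row_coord n (l : 'I_n) : continuous (row_coord l).
Proof. exact: coord_continuous. Qed.

Lemma diff_rV_coord V n (h : V -> 'rV[R]_n) x l : differentiable h x ->
  is_diff x (fun y => h y 0 l) (fun v => 'd h x v 0 l).
Proof.
move=> /differentiableP dh; exact: is_diff_comp dh (is_diff_linear _ (@continuous_row_coord _ l)).
Qed.

(** In coordinates the chain rule becomes a sum of scalar multiples, which can be differentiated
    again by the product rule. *)
Lemma diff_comp_rV V W n (h : V -> 'rV[R]_n) (g : 'rV[R]_n -> W) x v :
  differentiable h x -> differentiable g (h x) ->
  'd (g \o h) x v = \sum_(l < n) 'd (fun y => h y 0 l) x v *: 'd g (h x) (delta_mx 0 l).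
Proof.
move=> dh dg; rewrite diff_comp//= ['d h x v]row_sum_delta linear_sum.
by apply: eq_bigr => l _; rewrite linearZ/=; have [_ ->] := diff_rV_coord l dh.
Qed.

Lemma smooth_upto_coord V n p (U : set V) (h : V -> 'rV[R]_n) l :
  open U -> smooth_upto p U h ->
  smooth_upto p U (fun y => h y 0 l) /\
  forall vs x, (size vs <= p.+1)%N -> U x ->
    iter_diff vs (fun y => h y 0 l) x = iter_diff vs h x 0 l.
Proof. by move=> oU; exact: (smooth_upto_linear oU (@continuous_row_coord _ l)). Qed.

Lemma smooth_upto_comp V W n p (U : set V) (U' : set 'rV[R]_n) h (g : 'rV[R]_n -> W) :
  open U -> open U' -> (forall x, U x -> U' (h x)) ->
  smooth_upto p U h -> smooth_upto p U' g -> smooth_upto p U (g \o h).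
Proof.
move=> oU oU' hU; elim: p g => [|p IH] g.
  move=> /smooth_upto0 h0 /smooth_upto0 g0; apply/smooth_upto0 => x Ux.
  by apply: differentiable_comp; [exact: h0|exact/g0/hU].
move=> hS /smooth_uptoS[g0 g1]; have hp := smooth_uptoW (leqnSn p) hS.
have dh x : U x -> differentiable h x by move=> Ux; exact: (hS [::]).
apply/smooth_uptoS; split=> [x Ux|v].
  by apply: differentiable_comp; [exact: dh|exact/g0/hU].
have hl l : smooth_upto p U (fun x => 'd (fun y => h y 0 l) x v).
  by have [/smooth_uptoS[_ +] _] := smooth_upto_coord l oU hS; exact.
have [h1 _] := @smooth_upto_sum V W p U _ (index_enum 'I_n)
  (fun l x => 'd (fun y => h y 0 l) x v *: ((fun y => 'd g y (delta_mx 0 l)) \o h) x) oU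
  (fun l => smooth_upto_scale oU (hl l) (IH _ hp (g1 (delta_mx 0 l)))).
apply: (eq_smooth_upto oU _ h1).1 => x Ux.
by rewrite diff_comp_rV//; [exact: dh|exact/g0/hU].
Qed.

End IteratedDifferentials.

(** * Faa di Bruno bounds *)

(** The induction step of Leibniz' formula. The general [T] serves both the inequality for norms and
    the exact identity along one direction. *)
Lemma pascal_sum (M : nmodType) (T : nat -> nat -> M) n :
  \sum_(k < n.+2) T k (n.+1 - k)%N *+ 'C(n.+1, k) =
  \sum_(k < n.+1) T k.+1 (n - k)%N *+ 'C(n, k) +
  \sum_(k < n.+1) T k (n - k).+1 *+ 'C(n, k).
Proof.
rewrite big_ord_recl /= !bin0 subn0.
under eq_bigr => i _ do rewrite /bump /= add1n binS subSS mulrnDr.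
rewrite big_split/= addrA [RHS]addrC; congr (_ + _).
rewrite [in RHS]big_ord_recl bin0 subn0; congr (_ + _).
rewrite big_ord_recr/= bin_small// mulr0n addr0; apply: eq_bigr => i _.
by rewrite /bump/= add1n subnSK.
Qed.

Section Majorants.
Variable R : realType.
Implicit Types G H : nat -> R.

Definition inner_poly N H : {poly R} :=
  \poly_(k < N.+1) (if k is 0 then 0 else H k / k`!%:R).

Definition outer_poly S G (P : {poly R}) : {poly R} :=
  \sum_(s < S) (G s / s`!%:R) *: P ^+ s.

(* The [n]-th derivative at 0 of [G \o H] for the formal exponential generating
   functions of [G] and [H] (with [H 0] replaced by 0, truncated at [S] and [N]);
   Faa di Bruno's formula enters only through the recursion [fdbS]. *)
Definition fdb S G H N n : R :=
  n`!%:R * (outer_poly S G (inner_poly N H))`_n.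

Lemma inner_poly0 N H : (inner_poly N H)`_0 = 0.
Proof. by rewrite coef_poly. Qed.

Lemma fdb0 S G H N : fdb S.+1 G H N 0 = G 0.
Proof.
rewrite /fdb /outer_poly fact0 mul1r coef_sum big_ord_recl big1 => [|i _].
  by rewrite expr0 coefZ coef1 fact0 divr1 mulr1 addr0.
by rewrite coefZ exprS -horner_coef0 hornerM horner_coef0 inner_poly0 mul0r mulr0.
Qed.

Lemma fact_neq0 k : k`!%:R != 0 :> R.
Proof. by rewrite pnatr_eq0 -lt0n fact_gt0. Qed.

Lemma deriv_outer_poly S G P :
  (outer_poly S.+1 G P)^`() = P^`() * outer_poly S (fun s => G s.+1) P.
Proof.
rewrite /outer_poly big_ord_recl derivD expr0 derivZ derivC scaler0 add0r.
rewrite raddf_sum mulr_sumr; apply: eq_bigr => i _ /=.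
rewrite derivZ deriv_exp /bump/= add1n -scalerAr -[_ *+ i.+1]scaler_nat scalerA.
congr (_ *: _).
by rewrite factS natrM; field; rewrite fact_neq0 addrC natr1 pnatr_eq0.
Qed.

(** This is the chain rule [deriv_outer_poly] read on coefficients: shifting [G] differentiates the
    outer function and costs one term of its truncation, and only [H k] with k <= n+1 <= N are
    met. *)
Lemma fdbS S G H N n : (n < N)%N ->
  fdb S.+1 G H N n.+1 =
  \sum_(k < n.+1) (H k.+1 * fdb S (fun s => G s.+1) H N (n - k)) *+ 'C(n, k).
Proof.
move=> nN; rewrite /fdb factS natrM -mulrA mulrCA.
have -> : n.+1%:R * (outer_poly S.+1 G (inner_poly N H))`_n.+1 =
    (outer_poly S.+1 G (inner_poly N H))^`()`_n by rewrite coef_deriv mulr_natl.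
rewrite deriv_outer_poly coefM mulr_sumr; apply: eq_bigr => -[k /= kn] _.
rewrite coef_deriv coef_poly ltnS (leq_ltn_trans _ nN)//.
have -> : n`!%:R = ('C(n, k) * (k`! * (n - k)`!))%:R :> R by rewrite bin_fact.
rewrite -[RHS]mulr_natl factS !natrM -mulr_natl.
by field; rewrite fact_neq0 addrC natr1 pnatr_eq0.
Qed.

End Majorants.

Section Bounds.
Variable R : realType.
Implicit Types (V W : normedModType R) (A B G H : nat -> R).

(** The predicate [D] on directions is the unit ball in the class estimates, and membership in one
    fixed list where a maximum over finitely many lists is taken. *)
Definition bounded_upto V W n (D : pred V) (f : V -> W) x A :=
  forall vs, all D vs -> (size vs <= n)%N -> `|iter_diff vs f x| <= A (size vs).

Lemma bounded_upto_diff V W n (D : pred V) (f : V -> W) x A v :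
  D v -> bounded_upto n.+1 D f x A ->
  bounded_upto n D (fun y => 'd f y v) x (fun k => A k.+1).
Proof.
move=> Dv fA vs Dvs vsn; rewrite -iter_diff_rcons.
by have := fA (rcons vs v); rewrite all_rcons Dv Dvs size_rcons; exact.
Qed.

Lemma bounded_uptoW V W n p (D : pred V) (f : V -> W) x A :
  (p <= n)%N -> bounded_upto n D f x A -> bounded_upto p D f x A.
Proof. by move=> pn fA vs Dvs /leq_trans/(_ pn); exact: fA. Qed.

Lemma iter_diff_scale_rcons V W (U : set V) (u : V -> R) (w : V -> W) vs v x :
  open U -> U x -> smooth U u -> smooth U w ->
  iter_diff (rcons vs v) (fun y => u y *: w y) x =
  iter_diff vs (fun y => 'd u y v *: w y) x + iter_diff vs (fun y => u y *: 'd w y v) x.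
Proof.
move=> oU Ux /smoothP us /smoothP ws; rewrite iter_diff_rcons.
have /smooth_uptoS[u0 u1] := us (size vs).+1; have /smooth_uptoS[w0 w1] := ws (size vs).+1.
have s1 := smooth_upto_scale oU (u1 v) (ws _).
have s2 := smooth_upto_scale oU (us _) (w1 v).
have [s3 <-] := smooth_upto_add oU s1 s2 => //.
apply: (eq_smooth_upto oU _ s3).2 => // y Uy.
have du := differentiableP (u0 _ Uy); have dw := differentiableP (w0 _ Uy).
by have [_ ->] := is_diffZf du dw; rewrite addrC.
Qed.

Lemma leibniz_bound V W (U : set V) D (u : V -> R) (w : V -> W) A B x vs :
  open U -> U x -> smooth U u -> smooth U w ->
  bounded_upto (size vs) D u x A -> bounded_upto (size vs) D w x B -> all D vs ->
  `|iter_diff vs (fun y => u y *: w y) x|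
    <= \sum_(k < (size vs).+1) (A k * B (size vs - k)%N) *+ 'C(size vs, k).
Proof.
move=> oU Ux; elim/last_ind: vs u w A B => [|vs v IH] u w A B us ws uA wB.
  move=> _; rewrite big_ord1 bin0 /= normrZ ler_pM//; first exact: (uA [::]).
  exact: (wB [::]).
rewrite all_rcons => /andP[Dv Dvs].
rewrite (iter_diff_scale_rcons _ _ oU Ux us ws); apply: le_trans (ler_normD _ _) _.
rewrite size_rcons in uA wB *; rewrite (pascal_sum (fun i j => A i * B j)).
have du : smooth U (fun y => 'd u y v).
  by apply/smoothP => n; have /smoothP/(_ n.+1)/smooth_uptoS[] := us.
have dw : smooth U (fun y => 'd w y v).
  by apply/smoothP => n; have /smoothP/(_ n.+1)/smooth_uptoS[] := ws.
have nn := leqnSn (size vs); have uA' := bounded_uptoW nn uA.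
have wB' := bounded_uptoW nn wB.
apply: lerD.
  by apply: (IH _ _ (fun k => A k.+1) B) => //; apply: bounded_upto_diff.
by apply: (IH _ _ A (fun k => B k.+1)) => //; apply: bounded_upto_diff.
Qed.

Lemma row_norm_le n (u : 'rV[R]_n) c :
  0 <= c -> (`|u| <= c) <-> (forall l, `|u 0 l| <= c).
Proof.
move=> c0; rewrite [`|u|]/Num.Def.normr /= mx_normrE; split=> [/bigmax_leP[_ uc] l|uc].
  exact: (uc (ord0, l)).
by apply/bigmax_leP; split=> // -[i l] _ /=; rewrite (ord1 i).
Qed.

Lemma norm_row_coord n (u : 'rV[R]_n) l : `|u 0 l| <= `|u|.
Proof. exact: (row_norm_le u (normr_ge0 u)).1. Qed.

Lemma norm_delta_mx n (l : 'I_n) : `|delta_mx 0 l : 'rV[R]_n| <= 1.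
Proof.
apply/row_norm_le => // i; rewrite mxE eqxx.
by case: eqVneq => _; rewrite ?normr1 ?normr0.
Qed.

Definition unit_ball V : pred V := fun v => `|v| <= 1.
Arguments unit_ball {V}.

(* The directions [vs] are left arbitrary: no multilinearity or symmetry of the
   iterated differentials is needed. *)
Lemma composition_bound V W n (U : set V) (U' : set 'rV[R]_n) (D : pred V) h
    (g : 'rV[R]_n -> W) G H N S x vs :
  open U -> open U' -> (forall x, U x -> U' (h x)) -> U x ->
  smooth U h -> smooth U' g ->
  (forall ws, all D ws -> (0 < size ws <= N)%N -> `|iter_diff ws h x| <= H (size ws)) ->
  (forall p, bounded_upto p unit_ball g (h x) G) ->
  all D vs -> (size vs <= N)%N -> (size vs < S)%N ->
  `|iter_diff vs (g \o h) x| <= fdb S G (fun k => n%:R * H k) N (size vs).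
Proof.
move=> oU oU' hU Ux hs gs hH; elim: S vs g G gs => // S IH vs g G gs gG.
case/lastP: vs => [|vs v]; first by rewrite fdb0 => _ _ _; exact: (gG 0 [::]).
rewrite all_rcons size_rcons ltnS => /andP[Dv Dvs] vsN vsS.
rewrite fdbS//.
have dc l : smooth U (fun y => 'd (fun z => h z 0 l) y v).
  apply/smoothP => p; move/smoothP/(_ p.+1): hs => hs.
  by have [/smooth_uptoS[_ +] _] := smooth_upto_coord l oU hs; exact.
have dg l : smooth U' (fun y => 'd g y (delta_mx 0 l)).
  by apply/smoothP => p; move/smoothP/(_ p.+1)/smooth_uptoS: gs => [].
have dgh l : smooth U ((fun y => 'd g y (delta_mx 0 l)) \o h).
  apply/smoothP => p; move/smoothP/(_ p): hs => hs.
  by have /smoothP/(_ p) := dg l; exact: smooth_upto_comp.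
have [s1 s2] := @smooth_upto_sum _ V W (size vs) U _ (index_enum 'I_n)
  (fun l y => 'd (fun z => h z 0 l) y v *: ((fun y => 'd g y (delta_mx 0 l)) \o h) y) oU
  (fun l => smooth_upto_scale oU ((smoothP _ _).1 (dc l) _) ((smoothP _ _).1 (dgh l) _)).
rewrite iter_diff_rcons (eq_smooth_upto oU _ s1).2//; last first.
  move=> y Uy; rewrite diff_comp_rV//; first exact: (hs [::]).
  exact/(gs [::])/hU.
rewrite s2//; apply: le_trans (ler_norm_sum _ _ _) _.
(* All [n] coordinates obey the same bound; this is the origin of the factor [n%:R] in front of
   [H]. *)
rewrite [leRHS](_ : _ = \sum_(l < n) \sum_(k < (size vs).+1)
    (H k.+1 * fdb S (fun s => G s.+1) (fun k => n%:R * H k) N (size vs - k)) *+ 'C(size vs, k)).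
  apply: ler_sum => l _.
  apply: (leibniz_bound (D := D) (A := fun k => H k.+1)
    (B := fdb S (fun s => G s.+1) (fun k => n%:R * H k) N) oU Ux (dc l) (dgh l)) => //.
    move=> ws Dws wsvs; rewrite -iter_diff_rcons.
    move/smoothP/(_ (size ws).+1): hs => hs'.
    have [_ ->//] := smooth_upto_coord l oU hs'; last by rewrite size_rcons.
    apply: le_trans (norm_row_coord _ _) _; rewrite -(size_rcons ws v); apply: hH.
      by rewrite all_rcons Dv.
    by rewrite size_rcons (leq_ltn_trans wsvs).
  move=> ws Dws wsvs; apply: IH => //; [|lia|lia].
  move=> p us Dus usp; rewrite -iter_diff_rcons.
  rewrite -(size_rcons us (delta_mx 0 l)); apply: (gG p.+1); last by rewrite size_rcons.
  by rewrite all_rcons Dus andbT; exact: norm_delta_mx.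
rewrite sumr_const card_ord -[RHS]mulr_natl mulr_sumr; apply: eq_bigr => k _.
by rewrite mulrnAr mulrA.
Qed.

End Bounds.

(** * Majorant series *)

Section CoefficientOrder.
Variable R : realType.
Implicit Types (P Q : {poly R}) (t : R) (n s : nat).

Definition coef_le P Q := forall k, P`_k <= Q`_k.

Lemma coef_leM P P' Q Q' :
  coef_le 0 P -> coef_le 0 P' -> coef_le P Q -> coef_le P' Q' ->
  coef_le (P * P') (Q * Q').
Proof.
move=> P0 P0' PQ PQ' k; rewrite !coefM; apply: ler_sum => i _.
by apply: ler_pM => //; [have := P0 i|have := P0' (k - i)%N]; rewrite coef0.
Qed.

Lemma coef_ge0M P Q : coef_le 0 P -> coef_le 0 Q -> coef_le 0 (P * Q).
Proof. by move=> P0 Q0 k; have := @coef_leM 0 0 P Q; rewrite mulr0; apply. Qed.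

Lemma coef_ge0X P s : coef_le 0 P -> coef_le 0 (P ^+ s).
Proof.
move=> P0; elim: s => [|s IH]; last by rewrite exprS; exact: coef_ge0M.
by move=> k; rewrite expr0 coef0 coef1; case: (k == 0).
Qed.

Lemma coef_leX P Q s : coef_le 0 P -> coef_le P Q -> coef_le (P ^+ s) (Q ^+ s).
Proof.
move=> P0 PQ; elim: s => [//|s IH]; rewrite !exprS.
by apply: coef_leM => //; exact: coef_ge0X.
Qed.

Lemma coef_le_horner P Q t : coef_le P Q -> 0 <= t -> P.[t] <= Q.[t].
Proof.
move=> PQ t0; pose n := maxn (size P) (size Q).
rewrite (horner_coef_wide _ (leq_maxl _ _ : size P <= n)%N).
rewrite (horner_coef_wide _ (leq_maxr _ _ : size Q <= n)%N).
by apply: ler_sum => i _; rewrite ler_wpM2r ?exprn_ge0.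
Qed.

Lemma coef_horner_le P t n : coef_le 0 P -> 0 <= t -> P`_n * t ^+ n <= P.[t].
Proof.
move=> P0 t0; have := @coef_le_horner (P`_n *: 'X^n) P t.
rewrite hornerZ hornerXn; apply => // k; rewrite coefZ coefXn.
by case: eqVneq => [->|_]; rewrite ?mulr1// mulr0; have := P0 k; rewrite coef0.
Qed.

Lemma geometric_sum_le (q : R) n : 0 <= q <= 1 / 2 -> \sum_(k < n) q ^+ k <= 2.
Proof.
move=> /andP[q0 q1]; elim: n => [|n IH]; first by rewrite big_ord0.
rewrite big_ord_recl expr0; under eq_bigr => i _ do rewrite lift0 exprS.
by rewrite -mulr_sumr; nra.
Qed.

End CoefficientOrder.

Section Estimates.
Variable R : realType.
Implicit Types (G H : nat -> R) (beta rho : R).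

Lemma inner_poly_ge0 N H : (forall k, (0 < k <= N)%N -> 0 <= H k) ->
  coef_le 0 (inner_poly N H).
Proof.
move=> H0 k; rewrite coef0 coef_poly; case: ifP => // kN; case: k kN => // k kN.
by rewrite divr_ge0// H0.
Qed.

(** At half the radius of convergence of the majorant, the k-th term is at most (C / beta)
    2^(-k). *)
Lemma inner_poly_geometric N H C rho beta : 0 < rho -> 0 < beta -> 0 <= C ->
  (forall k, (0 < k <= N)%N -> H k / k`!%:R <= C * rho ^+ k * beta ^+ k.-1) ->
  (inner_poly N H).[(2 * rho * beta)^-1] <= C / beta.
Proof.
move=> rho0 beta0 C0 HC; rewrite /inner_poly horner_poly big_ord_recl mul0r add0r.
under eq_bigr => i _ do rewrite lift0.
set t := _^-1.
have E (i : 'I_N) : H i.+1 / i.+1`!%:R * t ^+ i.+1 <= C / beta / 2 * (1 / 2) ^+ i.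
  have t0 : 0 <= t by rewrite /t invr_ge0 !mulr_ge0// ltW.
  apply: le_trans (ler_wpM2r (exprn_ge0 _ t0) (HC i.+1 _)) _; first by rewrite /= ltn_ord.
  rewrite /t /= !exprVn div1r exprVn !exprMn !exprS.
  rewrite le_eqVlt; apply/orP; left; apply/eqP; field.
  by rewrite ?expf_neq0 ?gt_eqF// ?pnatr_eq0.
apply: le_trans (ler_sum _ (fun i _ => E i)) _.
rewrite -mulr_sumr; have := @geometric_sum_le R (1/2) N.
have : 0 <= C / beta by rewrite divr_ge0// ltW.
set q := C / beta; set S := \sum_(_ < _) _ => q0 hS.
have : S <= 2 by apply: hS; lra.
by nra.
Qed.

(** Cauchy's estimate at t = 1 / (2 rho beta): the n-th coefficient of P^s is at most P(t)^s / t^n,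
    where P(t) <= Ch / beta. Whatever s is, the powers of beta combine to beta^(s-1) beta^n / beta^s
    = beta^(n-1). *)
Lemma fdb_geometric Cg Ch rho : 0 < rho -> 0 <= Cg -> 0 <= Ch ->
  exists2 K : R, 0 < K & forall n beta G H, (0 < n)%N -> 0 < beta ->
    (forall s, (0 < s <= n)%N -> G s / s`!%:R <= Cg * rho ^+ s * beta ^+ s.-1) ->
    (forall k, (0 < k <= n)%N -> 0 <= H k) ->
    (forall k, (0 < k <= n)%N -> H k / k`!%:R <= Ch * rho ^+ k * beta ^+ k.-1) ->
    fdb n.+1 G H n n <= Cg * K ^+ n * n`!%:R * beta ^+ n.-1.
Proof.
(* Of the factor 4, one 2 comes from t and one from bounding the number n of summands by 2^n. The 1
   makes the base at least 1, so that its powers s <= n stay below the n-th. *)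
move=> rho0 Cg0 Ch0; exists (4 * rho * (1 + rho * Ch)).
  by have := mulr_ge0 (ltW rho0) Ch0; nra.
move=> n beta G H n0 beta0 hG H0 hH; rewrite /fdb.
set P := inner_poly n H; have P0 : coef_le 0 P by exact: inner_poly_ge0.
set t := (2 * rho * beta)^-1.
have t0 : 0 < t by rewrite /t invr_gt0 !mulr_gt0.
have Pt : P.[t] <= Ch / beta by exact: inner_poly_geometric.
have Pt0 : 0 <= P.[t] by have := coef_le_horner P0 (ltW t0); rewrite horner0.
have cP s : (P ^+ s)`_n <= (2 * rho * beta) ^+ n * (Ch / beta) ^+ s.
  rewrite mulrC -ler_pdivrMr ?exprn_gt0 ?mulr_gt0// -exprVn -/t.
  apply: le_trans (coef_horner_le n (coef_ge0X s P0) (ltW t0)) _.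
  by rewrite horner_exp lerXn2r// nnegrE// divr_ge0// ltW.
have cP0 : (P ^+ 0)`_n = 0 by rewrite expr0 coef1; case: n n0 {hG H0 hH P P0 Pt Pt0 cP}.
rewrite [leRHS](_ : _ = n`!%:R * (Cg * (2 * rho) ^+ n * beta ^+ n.-1 *
   (2 ^+ n * (1 + rho * Ch) ^+ n))); last first.
  by rewrite (_ : 4 = 2 * 2 :> R); [rewrite !exprMn; ring|ring].
apply: ler_wpM2l => //.
rewrite /outer_poly coef_sum big_ord_recl coefZ cP0 mulr0 add0r.
have E (i : 'I_n) : ((G (lift ord0 i) / (lift ord0 i)`!%:R) *: P ^+ lift ord0 i)`_n <=
    Cg * (2 * rho) ^+ n * beta ^+ n.-1 * (1 + rho * Ch) ^+ n.
  rewrite coefZ lift0; set s := i.+1.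
  have sn : (0 < s <= n)%N by rewrite /= ltn_ord.
  have Ps0 : 0 <= (P ^+ s)`_n by have := coef_ge0X s P0 n; rewrite coef0.
  apply: le_trans (ler_wpM2r Ps0 (hG s sn)) _.
  apply: le_trans (ler_wpM2l _ (cP s)) _.
    by rewrite !mulr_ge0// ?exprn_ge0// ltW.
  have E1 : (rho * Ch) ^+ s <= (1 + rho * Ch) ^+ n.
    have x0 : 0 <= rho * Ch by rewrite mulr_ge0// ltW.
    apply: (@le_trans _ _ ((1 + rho * Ch) ^+ s)).
      by rewrite lerXn2r// ?nnegrE; lra.
    by apply: ler_weXn2l; [lra|case/andP: sn].
  rewrite [leLHS](_ : _ = Cg * (2 * rho) ^+ n * beta ^+ n.-1 * (rho * Ch) ^+ s).
    by apply: ler_wpM2l => //; rewrite !mulr_ge0// ?exprn_ge0 ?mulr_ge0// ltW.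
  rewrite /s /= (_ : beta ^+ n.-1 = beta ^+ n / beta); last first.
    by rewrite -[in RHS](prednK n0) exprSr mulfK// gt_eqF.
  by rewrite !exprMn exprVn !exprS; field; rewrite expf_neq0 ?gt_eqF.
apply: le_trans (ler_sum _ (fun i _ => E i)) _.
rewrite sumr_const card_ord -[leLHS]mulr_natr -[leLHS]mulrA; apply: ler_wpM2l.
  by rewrite !mulr_ge0// ?exprn_ge0 ?mulr_ge0// ltW.
rewrite mulrC; apply: ler_wpM2r.
  by rewrite exprn_ge0// addr_ge0// mulr_ge0// ltW.
by rewrite -natrX ler_nat ltnW// ltn_expl.
Qed.

Lemma coef_ge0_outer S G P : (forall s, (s < S)%N -> 0 <= G s) ->
  coef_le 0 P -> coef_le 0 (outer_poly S G P).
Proof.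
move=> G0 P0 k; rewrite coef0 coef_sum; apply: sumr_ge0 => i _; rewrite coefZ.
by rewrite mulr_ge0 ?divr_ge0 ?G0//; have := coef_ge0X i P0 k; rewrite coef0.
Qed.

Lemma coef_le_outer S G P Q : (forall s, (s < S)%N -> 0 <= G s) ->
  coef_le 0 P -> coef_le P Q -> coef_le (outer_poly S G P) (outer_poly S G Q).
Proof.
move=> G0 P0 PQ k; rewrite !coef_sum; apply: ler_sum => i _; rewrite !coefZ.
by rewrite ler_wpM2l ?divr_ge0 ?G0//; exact: coef_leX.
Qed.

(* Cauchy's majorant for [x = A t + \sum_(s >= 2) G_s x^s / s!]: the partial sums
   of the series of coefficients [H k / k!], evaluated at [t = tau / beta], stay
   below [delta / beta]. *)
Lemma inverse_geometric A B rho : 0 < rho -> 0 <= A -> 0 <= B ->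
  exists D K : R, [/\ 0 < D, 0 < K & forall S N beta G H, 0 < beta ->
    G 0 = 0 -> G 1 = 0 -> (forall s, (s < S.+2)%N -> 0 <= G s) ->
    (forall s, (1 < s < S.+2)%N -> G s / s`!%:R <= B * rho ^+ s * beta ^+ s.-1) ->
    (forall k, (0 < k <= N)%N -> 0 <= H k) -> H 1 <= A ->
    (forall n, (1 < n <= N)%N ->
      H n / n`!%:R <= (outer_poly S.+2 G (inner_poly n.-1 H))`_n) ->
    forall n, (0 < n <= N)%N -> H n / n`!%:R <= D * K ^+ n * beta ^+ n.-1].
Proof.
move=> rho0 A0 B0.
(* With [delta], the ratio [rho * delta] is at most 1/2 and the terms of degree at least 2 sum to at
   most delta / 2; [tau] keeps the linear term below the other delta / 2. *)
pose delta := (2 * rho + 4 * B * rho ^+ 2)^-1.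
pose tau := delta / (2 * A + 1).
have e0 : 0 < 2 * rho + 4 * B * rho ^+ 2 by have := mulr_ge0 B0 (sqr_ge0 rho); lra.
have delta0 : 0 < delta by rewrite invr_gt0.
have tau0 : 0 < tau by rewrite divr_gt0//; lra.
have hd1 : delta * (2 * rho + 4 * B * rho ^+ 2) = 1 by rewrite mulVf// gt_eqF.
have hd2 : 0 <= delta * (B * rho ^+ 2) by rewrite !mulr_ge0// ?sqr_ge0 ltW.
have hd3 : 0 < delta * rho by rewrite mulr_gt0.
have rd : rho * delta <= 1 / 2 by nra.
have Brd : 2 * (B * (rho * delta) ^+ 2) <= delta / 2.
  by rewrite exprMn; have := delta0; nra.
have Atau : A * tau <= delta / 2.
  rewrite /tau mulrA ler_pdivrMr; last by lra.
  by have := delta0; nra.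
exists delta, tau^-1; split=> //; first by rewrite invr_gt0.
move=> S N beta G H beta0 G0 G1 Gge0 hG Hge0 H1 hH.
pose t := tau / beta; have t0 : 0 < t by rewrite divr_gt0.
have hp0 n : (n <= N)%N -> coef_le 0 (inner_poly n H).
  move=> nN; apply: inner_poly_ge0 => k /andP[k0 kn].
  by rewrite Hge0// k0 (leq_trans kn).
have main n : (n <= N)%N -> (inner_poly n H).[t] <= delta / beta.
  elim: n => [_|n IH nN].
    by rewrite horner_poly big_ord1 mul0r divr_ge0// ltW.
  have pn := hp0 n (ltnW nN); have {}IH := IH (ltnW nN).
  have Pt0 : 0 <= (inner_poly n H).[t] by have := coef_le_horner pn (ltW t0); rewrite horner0.
  (* The k-th coefficient is controlled by those below k, so each partial sum is dominated by the
     right-hand side of the functional equation at the preceding one. *)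
  have le1 : coef_le (inner_poly n.+1 H) (A *: 'X + outer_poly S.+2 G (inner_poly n H)).
    move=> k; rewrite coefD coefZ coefX coef_poly.
    have o0 := coef_ge0_outer Gge0 pn k; rewrite coef0 in o0.
    case: ifP => kn; last by rewrite addr_ge0// mulr_ge0.
    case: k kn o0 => [|[|k]] kn o0; first by rewrite addr_ge0// mulr_ge0.
      by rewrite eqxx (_ : 1`!%N = 1%N)// divr1 mulr1 -[leLHS]addr0 lerD.
    rewrite ltnS in kn; have kN := leq_trans kn nN.
    rewrite mulr0 add0r; apply: le_trans (hH k.+2 kN) _.
    apply: coef_le_outer => //; first exact/hp0/ltnW.
    move=> j; rewrite !coef_poly; case: ifP => [jk|_].
      by rewrite (leq_trans jk kn).
    have := pn j; rewrite coef0 coef_poly; exact.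
  apply: le_trans (coef_le_horner le1 (ltW t0)) _.
  rewrite hornerD hornerZ hornerX /outer_poly horner_sum !big_ord_recl.
  rewrite !lift0 G0 G1 !mul0r !scale0r !horner0 !add0r.
  have E (i : 'I_S) : ((G (lift ord0 (lift ord0 i)) / (lift ord0 (lift ord0 i))`!%:R) *:
      inner_poly n H ^+ (lift ord0 (lift ord0 i))).[t] <=
      (B * (rho * delta) ^+ 2 / beta) * (rho * delta) ^+ i.
    rewrite hornerZ horner_exp !lift0.
    apply: le_trans (ler_wpM2r (exprn_ge0 _ Pt0) (hG i.+2 _)) _; first by rewrite !ltnS ltn_ord.
    apply: (@le_trans _ _ (B * rho ^+ i.+2 * beta ^+ i.+1 * (delta / beta) ^+ i.+2)).
      apply: ler_wpM2l; first by apply: mulr_ge0; [apply: mulr_ge0|]; rewrite ?exprn_ge0// ltW.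
      by rewrite lerXn2r// nnegrE divr_ge0// ltW.
    rewrite le_eqVlt; apply/orP; left; apply/eqP.
    by rewrite expr_div_n !exprMn !exprS; field; rewrite ?expf_neq0 ?gt_eqF.
  apply: le_trans (lerD (lexx _) (ler_sum _ (fun i _ => E i))) _.
  rewrite -mulr_sumr.
  have := @geometric_sum_le R (rho * delta) S; set Sg := \sum_(_ < _) _ => hS.
  have {hS} : Sg <= 2 by apply: hS; rewrite rd mulr_ge0// ltW.
  rewrite /t mulrA [_ / beta * Sg]mulrAC -mulrDl ler_pM2r ?invr_gt0// => S2.
  have := ler_wpM2l (mulr_ge0 B0 (sqr_ge0 (rho * delta))) S2.
  by lra.
move=> n /andP[n0 nN]; rewrite exprVn.
have := coef_horner_le n (hp0 n nN) (ltW t0).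
rewrite coef_poly ltnSn; case: n n0 nN => // n _ nN.
move=> /le_trans/(_ (main _ nN)); rewrite -ler_pdivlMr ?exprn_gt0// => /le_trans; apply.
rewrite /t expr_div_n le_eqVlt; apply/orP; left; apply/eqP => /=.
by rewrite !exprS; field; rewrite ?expf_neq0 ?gt_eqF.
Qed.

End Estimates.

(** * Sufficiency of the growth condition *)

Section ClassBounds.
Variables (R : realType) (m : nat -> R).
Hypothesis m_gt0 : forall n, (1 <= n)%N -> 0 < m n.

Definition class_bound (V W : normedModType R) (A : set V) (f : V -> W) (C rho : R) :=
  forall x vs, A x -> all (@unit_ball R V) vs -> (0 < size vs)%N ->
    `|iter_diff vs f x| <= C * rho ^+ size vs * ((size vs)`!%:R * m (size vs)).

Lemma classE_bounds (V W : normedModType R) (U : set V) (f : V -> W) :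
  classE m U f <->
  [/\ open U, smooth U f & forall x0, U x0 -> exists A C rho,
    [/\ nbhs x0 A, A `<=` U, 0 <= C, 0 < rho & class_bound A f C rho]].
Proof.
split=> -[oU sU bU]; split=> // x0 /bU.
- move=> [A [r [nA AU r0 supA]]]; set S := ereal_sup _ in supA.
  (* The maximum makes the constant nonnegative and still bounds [S] should it be [-oo]. *)
  exists A, (Num.max 0 (fine S)), r^-1; split=> //; first by rewrite le_max lexx.
    by rewrite invr_gt0.
  move=> x vs Ax uvs nvs; set n := size vs.
  have SM : (S <= (Num.max 0 (fine S))%:E)%E.
    by case: S supA => [s||]//= _; rewrite ?leNye// lee_fin le_max lexx orbT.
  have h1 : ((n`!%:R^-1)%:E * (diff_norm n f x * ((m n)^-1)%:E) * (r ^+ n)%:E <= S)%E.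
    by apply: ereal_sup_ubound; exists x => //; exists n.
  have h2 : (`|iter_diff vs f x|%:E <= diff_norm n f x)%E.
    apply: ereal_sup_ubound; exists (in_tuple vs) => //.
    by move=> i; have /all_tnthP := (uvs : all _ (in_tuple vs)); exact.
  have h3 : (((n`!%:R^-1) * (`|iter_diff vs f x| * (m n)^-1) * r ^+ n)%:E <=
      (Num.max 0 (fine S))%:E)%E.
    apply: le_trans SM; apply: le_trans h1; rewrite !EFinM.
    have mn := m_gt0 nvs.
    apply: lee_wpmul2r; first by rewrite lee_fin exprn_ge0// ltW.
    apply: lee_wpmul2l; first by rewrite lee_fin invr_ge0.
    by apply: lee_wpmul2r => //; rewrite lee_fin invr_ge0 ltW.
  rewrite lee_fin in h3; rewrite exprVn.
  have mn := m_gt0 nvs.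
  have rn : 0 < r ^+ n by rewrite exprn_gt0.
  have fn : 0 < n`!%:R :> R by rewrite ltr0n fact_gt0.
  have -> : `|iter_diff vs f x| = (n`!%:R^-1 * (`|iter_diff vs f x| / m n) * r ^+ n) *
     ((r ^+ n)^-1 * (n`!%:R * m n)) by field; rewrite !gt_eqF.
  rewrite -[leRHS]mulrA; apply: ler_wpM2r => //.
  by rewrite mulr_ge0 ?invr_ge0 ?mulr_ge0// ltW.
- move=> [A [C [rho [nA AU C0 rho0 bA]]]]; exists A, rho^-1; split=> //.
    by rewrite invr_gt0.
  apply: (@le_lt_trans _ _ C%:E); last exact: ltry.
  apply: ge_ereal_sup => _ [x Ax [n n1 <-]].
  have mn := m_gt0 n1.
  have rn : 0 < rho ^+ n by rewrite exprn_gt0.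
  have fn : 0 < n`!%:R :> R by rewrite ltr0n fact_gt0.
  have dn : (diff_norm n f x <= (C * rho ^+ n * (n`!%:R * m n))%:E)%E.
    apply: ge_ereal_sup => _ [v uv <-]; rewrite lee_fin.
    have := bA x v Ax; rewrite size_tuple; apply => //; exact/all_tnthP.
  apply: (@le_trans _ _ ((n`!%:R^-1)%:E * ((C * rho ^+ n * (n`!%:R * m n))%:E * ((m n)^-1)%:E)
     * (rho^-1 ^+ n)%:E)%E).
    apply: lee_wpmul2r; first by rewrite lee_fin exprn_ge0// invr_ge0 ltW.
    apply: lee_wpmul2l; first by rewrite lee_fin invr_ge0 ltW.
    by apply: lee_wpmul2r => //; rewrite lee_fin invr_ge0 ltW.
  rewrite -!EFinM lee_fin exprVn le_eqVlt; apply/orP; left; apply/eqP.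
  by field; rewrite !gt_eqF.
Qed.

Lemma classE_intro (V W : normedModType R) (U : set V) (f : V -> W) :
  open U -> smooth U f ->
  (forall x0, U x0 -> exists A C rho,
    [/\ nbhs x0 A, 0 <= C, 0 < rho & class_bound A f C rho]) ->
  classE m U f.
Proof.
move=> oU sU bU; apply/classE_bounds; split=> // x0 Ux0.
have [A [C [rho [nA C0 rho0 bA]]]] := bU x0 Ux0.
exists (A `&` U), C, rho; split=> //.
- by apply: filterI => //; exact: open_nbhs_nbhs.
- by move=> x vs [Ax _]; exact: bA.
Qed.

(* The growth condition behind the three statements, with [beta = (m n)^(1/(n-1))]:
   up to geometric factors, [k |-> m k] is dominated for [k <= n] by
   [beta ^+ k.-1], with equality at [n]. *)
Definition geometric_majorant : Prop :=
  exists2 C : R, 1 <= C & forall n, (1 <= n)%N -> exists beta : R,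
    [/\ 0 < beta, forall k, (1 <= k <= n)%N -> m k <= C ^+ k * beta ^+ k.-1 &
      beta ^+ n.-1 <= C ^+ n * m n].

(** The exponents of beta add up exactly: (r - 1) + \sum (k_i - 1) = n - 1. The cube pays for C^r <=
    C^n, for the product of the C^(k_i), and for the return from beta^(n-1) to m_n. *)
Lemma geometric_majorant_FdB : geometric_majorant -> FdB m.
Proof.
move=> [C C1 hC]; exists (C ^+ 3); first exact: exprn_ege1.
move=> r k r1 k1; set n := (\sum_(i < r) k i)%N.
have rn : (r <= n)%N.
  have : (\sum_(i < r) 1 <= n)%N by apply: leq_sum.
  by rewrite big_const_ord iter_addn mul1n addn0.
have C0 : 0 < C by exact: lt_le_trans C1.
have [//|beta [b0 hb hn]] := hC n; first exact: leq_trans rn.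
have kn i : (k i <= n)%N by rewrite /n (bigD1 i)//= leq_addr.
have P : \prod_(i < r) m (k i) <= \prod_(i < r) (C ^+ k i * beta ^+ (k i).-1).
  apply: ler_prod => i _; rewrite ltW ?m_gt0//= hb// kn andbT; exact: k1.
have E : \prod_(i < r) (C ^+ k i * beta ^+ (k i).-1) = C ^+ n * beta ^+ (n - r).
  rewrite big_split/= !prodrXr; congr (_ * _ ^+ _).
  have : (\sum_(i < r) ((k i).-1 + 1) = n)%N by apply: eq_bigr => i _; rewrite addn1 prednK ?k1.
  by rewrite big_split/= big_const_ord iter_addn mul1n addn0; lia.
rewrite E in P.
apply: le_trans (ler_pM _ _ (hb r _) P) _; [exact/ltW/m_gt0| |by rewrite r1|].
  by apply: prodr_ge0 => i _; exact/ltW/m_gt0.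
rewrite mulrACA -!exprD addnC.
have -> : (r.-1 + (n - r) = n.-1)%N by case: (r) r1 rn => // p _ pn; lia.
apply: (@le_trans _ _ (C ^+ (n + n) * (C ^+ n * m n))); last first.
  by rewrite mulrA -exprD -exprM; rewrite (_ : (n + n + n = 3 * n)%N)//; lia.
apply: ler_pM => //; first by rewrite exprn_ge0// ltW.
  by rewrite exprn_ge0// ltW.
by apply: ler_weXn2l => //; rewrite leq_add2l.
Qed.

End ClassBounds.

(** * Stability under composition *)

Section CompositionClosed.
Variables (R : realType) (m : nat -> R).
Hypothesis m_gt0 : forall n, (1 <= n)%N -> 0 < m n.

Lemma smooth_comp (V W : normedModType R) n (U : set V) (U' : set 'rV[R]_n) h
    (g : 'rV[R]_n -> W) :
  open U -> open U' -> (forall x, U x -> U' (h x)) ->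
  smooth U h -> smooth U' g -> smooth U (g \o h).
Proof.
move=> oU oU' hU /smoothP hs /smoothP gs; apply/smoothP => p.
exact: (smooth_upto_comp oU oU' hU).
Qed.

Lemma geometric_bound C1 rho1 rho C beta n s :
  0 <= C1 -> 0 <= rho1 -> 0 <= C -> 0 <= beta -> rho1 * C <= rho ->
  (forall k, (1 <= k <= n)%N -> m k <= C ^+ k * beta ^+ k.-1) ->
  (0 < s <= n)%N ->
  C1 * rho1 ^+ s * (s`!%:R * m s) / s`!%:R <= C1 * rho ^+ s * beta ^+ s.-1.
Proof.
move=> C10 r10 C0 b0 r1r hm sn.
rewrite [leLHS](_ : _ = C1 * rho1 ^+ s * m s); last first.
  by field; rewrite fact_neq0.
apply: le_trans (ler_wpM2l _ (hm s sn)) _; first by rewrite mulr_ge0 ?exprn_ge0.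
rewrite mulrA -[_ * C ^+ s]mulrA -exprMn; apply: ler_wpM2r; first exact: exprn_ge0.
apply: ler_wpM2l => //; rewrite lerXn2r// nnegrE ?mulr_ge0//.
exact: le_trans (mulr_ge0 r10 C0) r1r.
Qed.

Lemma composition_closed_majorant : geometric_majorant m -> composition_closed m.
Proof.
move=> [C C1 hC] a b W _ U V h g /(classE_bounds m_gt0)[oV sg bg].
move=> /(classE_bounds m_gt0)[oU sh bh] hU.
have C0 : 0 < C by exact: lt_le_trans C1.
have hUV x : U x -> V (h x) by move=> Ux; apply: hU; exists x.
apply: classE_intro => //; first exact: smooth_comp sh sg.
move=> x0 Ux0.
have [Ah [Ch [rh [nAh AhU Ch0 rh0 hAh]]]] := bh x0 Ux0.
have [Ag [Cg [rg [nAg AgV Cg0 rg0 hAg]]]] := bg _ (hUV _ Ux0).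
pose rho := (rg + rh) * C.
have rho0 : 0 < rho by rewrite mulr_gt0// addr_gt0.
have bC0 : 0 <= b%:R * Ch by rewrite mulr_ge0.
have [K K0 hK] := fdb_geometric rho0 Cg0 bC0.
exists (Ah `&` h @^-1` Ag), Cg, (K * C); split => //; last 2 first.
- by rewrite mulr_gt0.
- move=> x vs [Ahx Agx] uvs n0; set n := size vs.
  have [//|beta [b0 hb hn]] := hC n.
  (* The class estimate says nothing at order 0, and the value there does not affect the final
     bound, since the n-th coefficient of P^0 vanishes for n > 0. *)
  pose G s := if s is 0 then `|g (h x)| else Cg * rg ^+ s * (s`!%:R * m s).
  pose H k := Ch * rh ^+ k * (k`!%:R * m k).
  have Ux : U x by exact: AhU.
  have cb := @composition_bound _ _ _ _ _ _ (@unit_ball R _) h g G H n n.+1 x vs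
    oU oV hUV Ux sh sg.
  apply: le_trans (cb _ _ uvs (leqnn _) (ltnSn _)) _.
  + by move=> ws uws /andP[ws0 wsn]; exact: hAh.
  + by move=> p [_ _|w ws uws _] //; exact: hAg.
  apply: le_trans (hK n beta G _ n0 b0 _ _ _) _.
  + move=> s sn; rewrite /G; case: s sn => // s sn.
    apply: geometric_bound hb sn => //; try exact: ltW.
    by apply: ler_wpM2r; [exact: ltW|rewrite lerDl ltW].
  + move=> k /andP[k0 _]; rewrite !mulr_ge0 ?exprn_ge0//; try exact: ltW.
    exact/ltW/m_gt0.
  + move=> k kn; rewrite /H !mulrA -[_ * m k]mulrA.
    apply: geometric_bound hb kn => //; try exact: ltW.
    by apply: ler_wpM2r; [exact: ltW|rewrite lerDr ltW].
  rewrite exprMn [leRHS](_ : _ = Cg * K ^+ n * n`!%:R * (C ^+ n * m n)); last by ring.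
  by apply: ler_wpM2l => //; rewrite !mulr_ge0// exprn_ge0// ltW.
- apply: filterI => //; have := sh [::] x0 Ux0.
  by move=> /differentiable_continuous; exact.
Qed.

End CompositionClosed.

(** * Stability under inversion *)

Lemma finite_list_sup (R : realType) (T : eqType) (E : seq T) j (F : seq T -> R) :
  exists K : R, [/\ 0 <= K,
    forall ws, all (mem E) ws -> size ws = j -> F ws <= K &
    forall B, 0 <= B -> (forall ws, all (mem E) ws -> size ws = j -> F ws <= B) -> K <= B].
Proof.
elim: j F => [|j IH] F.
  exists (Num.max 0 (F [::])); split=> [||B B0 FB].
  - by rewrite le_max lexx.
  - by move=> [|//] _ _; rewrite le_max lexx orbT.
  - by rewrite ge_max B0 FB.
have /choice[Kf hKf] := fun v => IH (fun ws => F (v :: ws)).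
exists (\big[Num.max/0]_(v <- E) Kf v); split=> [||B B0 FB].
- by apply: bigmax_ge_id.
- move=> [//|v ws] /= /andP[vE wsE] [szws]; have [_ hv _] := hKf v.
  by apply: le_trans (hv _ wsE szws) _; exact: le_bigmax_seq.
- rewrite big_seq; apply: bigmax_le => // v vE; have [_ _ hv] := hKf v.
  apply: hv => // ws wsE szws; apply: FB; last by rewrite /= szws.
  by rewrite /= vE.
Qed.

Section CoefficientTruncation.
Variable R : realType.
Implicit Types (P Q : {poly R}) (G H : nat -> R).

(** In a product of at least two factors without constant term, degree n is reached only through
    coefficients of degree below n. *)
Lemma coefX_trunc P Q n s : P`_0 = 0 -> Q`_0 = 0 ->
  (forall k, (k < n)%N -> P`_k = Q`_k) ->
  (1 < s)%N -> (P ^+ s)`_n = (Q ^+ s)`_n.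
Proof.
move=> P0 Q0 PQ; case: s => [//|s]; rewrite ltnS.
have X0 (A : {poly R}) t : A`_0 = 0 -> (0 < t)%N -> (A ^+ t)`_0 = 0.
  move=> A0; case: t => // t _.
  by rewrite exprS coefM big_ord1 A0 mul0r.
have XE t k : (0 < t)%N -> (k < n)%N -> (P ^+ t)`_k = (Q ^+ t)`_k.
  elim: t k => // -[_ k _ kn|t IH k _ kn]; first by rewrite !expr1 PQ.
  rewrite exprS [in RHS]exprS !coefM; apply: eq_bigr => -[i /= ik] _.
  by rewrite PQ ?IH//; lia.
move=> s0; rewrite !exprS !coefM; apply: eq_bigr => -[i /= iN] _.
case: (posnP i) => [->|i0]; first by rewrite P0 Q0 !mul0r.
case: (ltnP i n) => ni; first by rewrite PQ// XE//; lia.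
have -> : (n - i = 0)%N by lia.
by rewrite !X0 // !mulr0.
Qed.

(** This turns the estimate for the inverse into a genuine recursion: without terms of order 0 and 1
    in [G], the n-th coefficient does not involve [H n]. *)
Lemma outer_coef_trunc S G H n : G 0 = 0 -> G 1 = 0 -> (0 < n)%N ->
  (outer_poly S G (inner_poly n H))`_n = (outer_poly S G (inner_poly n.-1 H))`_n.
Proof.
move=> G0 G1 n0; rewrite !coef_sum; apply: eq_bigr => -[[|[|s]] /= _] _.
- by rewrite G0 mul0r !scale0r.
- by rewrite G1 mul0r !scale0r.
rewrite !coefZ; congr (_ * _); apply: coefX_trunc; rewrite ?inner_poly0// => k kn.
by rewrite !coef_poly prednK// ltnS (ltnW kn) kn.
Qed.

Lemma outer_polyZ S G P a : outer_poly S (fun s => a * G s) P = a *: outer_poly S G P.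
Proof.
by rewrite scaler_sumr; apply: eq_bigr => i _; rewrite scalerA mulrA.
Qed.

End CoefficientTruncation.

Section Affine.
Variables (R : realType) (V W : normedModType R).

Lemma smooth_affine (l : {linear V -> W}) c (U : set V) : open U -> continuous l ->
  smooth U (fun x => l x + c) /\ forall vs x, U x ->
    iter_diff vs (fun x => l x + c) x =
    match vs with [::] => l x + c | [:: v] => l v | _ => 0 end.
Proof.
move=> oU lc.
pose F vs x := match vs with [::] => l x + c | [:: v] => l v | _ => 0 end.
have dF vs x : is_diff x (F vs) (fun v => F (v :: vs) x).
  case: vs => [|v [|w vs]]; try exact: is_diff_cst.
  rewrite -[X in is_diff _ _ X]addr0.
  exact: is_diffD (is_diff_linear x lc) (is_diff_cst c x).
have h n := @iter_diff_unique R V W n U F (fun x => l x + c) oU (fun=> fun=> erefl) (fun vs x _ _ => dF vs x).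
split; first by apply/smoothP => n; exact: (h n).1.
by move=> vs x Ux; apply: (h (size vs)).2.
Qed.

End Affine.

Section InverseRecursion.
Variables (R : realType) (s : nat).
Variables (U V : set 'rV[R]_s) (g k : 'rV[R]_s -> 'rV[R]_s).
Hypotheses (oU : open U) (oV : open V) (sg : smooth U g) (sk : smooth V k).
Hypotheses (kVU : forall y, V y -> U (k y)) (gk : forall y, V y -> g (k y) = y).
Hypothesis kg : forall x, U x -> V (g x) /\ k (g x) = x.

Lemma diff_inverseK y w : V y -> 'd k y ('d g (k y) w) = w.
Proof.
move=> Vy; have Ux := kVU Vy.
have dg : differentiable g (k y) by exact: (sg [::]).
have dk : differentiable k y by exact: (sk [::]).
have h : is_diff (k y) (k \o g) id.
  apply: (@is_diff_near _ _ _ id).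
  have := open_nbhs_nbhs (conj oU Ux).
  by apply: filterS => x /kg[_ /= ->].
have [_ hd] := h; have dk' := dk; rewrite -[X in differentiable k X](gk Vy) in dk'.
have hc := diff_comp dg dk'.
have hw := congr1 (fun f : 'rV[R]_s -> 'rV[R]_s => f w) (etrans (esym hc) hd).
by move: hw; rewrite (gk Vy).
Qed.

(* Subtracting from [g] its first order Taylor polynomial at [k y] makes the
   terms with [s <= 1] of the composition bound vanish, while
   [iter_diff vs ((g - affine) \o k) y = - 'd g (k y) (iter_diff vs k y)]
   once [vs] has length at least 2. *)
Lemma inverse_recursion y (D : pred 'rV[R]_s) (M : R) (G H : nat -> R) S vs :
  V y -> 0 <= M -> (forall w, `|'d k y w| <= M * `|w|) ->
  G 0 = 0 -> G 1 = 0 -> (forall ws, all (@unit_ball R _) ws -> (1 < size ws)%N ->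
    `|iter_diff ws g (k y)| <= G (size ws)) ->
  (forall ws, all D ws -> (0 < size ws <= size vs)%N -> `|iter_diff ws k y| <= H (size ws)) ->
  all D vs -> (1 < size vs < S)%N ->
  `|iter_diff vs k y| <= M * ((size vs)`!%:R *
    (outer_poly S G (inner_poly (size vs).-1 (fun j => s%:R * H j)))`_(size vs)).
Proof.
move=> Vy M0 dkM G0 G1 gG kH Dvs /andP[n1 nS].
have Ux := kVU Vy; have dg : differentiable g (k y) by exact: (sg [::]).
pose L : {linear 'rV[R]_s -> 'rV[R]_s} := \- 'd g (k y).
have Lc : continuous L.
  by move=> z; apply: continuousN; exact: diff_continuous.
pose c := - L (k y) - y.
(* The constant [c] makes g + L + c vanish at [k y], as [G 0 = 0] demands, and [L] cancels the first
   differential there. *)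
have [sL dL] := smooth_affine c oU Lc.
pose g1 z := g z + (L z + c).
have g1E p := smooth_upto_add oU ((smoothP _ _).1 sg p) ((smoothP _ _).1 sL p).
have sg1 : smooth U g1 by apply/smoothP => p; exact: (g1E p).1.
have bg1 p : bounded_upto p (@unit_ball R _) g1 (k y) G.
  move=> ws uws _; rewrite (g1E (size ws)).2// dL//.
  case: ws uws => [|v [|w ws]] uws /=.
  - by rewrite gk// /c [_ + (_ - y)]addrA subrr sub0r subrr normr0 G0.
  - by rewrite /L /= subrr normr0 G1.
  - by rewrite addr0; exact: (gG [:: v, w & ws]).
have := composition_bound oV oU kVU Vy sk sg1 kH bg1 Dvs (leqnn _) nS.
rewrite /fdb (outer_coef_trunc _ _ G0 G1) 1?(ltnW n1)//; set B := _ * _ => cB.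
have idc : continuous (idfun : {linear 'rV[R]_s -> 'rV[R]_s}) by move=> z; exact: cvg_id.
have [sI dI] := smooth_affine c oV idc.
have [sLk dLk] := smooth_upto_linear oV Lc ((smoothP _ _).1 sk (size vs)).
have [sA dA] := smooth_upto_add oV ((smoothP _ _).1 sI (size vs)) sLk.
have E : iter_diff vs (g1 \o k) y = - 'd g (k y) (iter_diff vs k y).
  have e z : V z -> idfun z + c + L (k z) = (g1 \o k) z.
    by move=> Vz /=; rewrite /g1 gk// -addrA [c + _]addrC.
  rewrite (eq_smooth_upto oV e sA).2//.
  by rewrite dA// dLk// dI//; case: (vs) n1 => [//|v [//|w ws]] _; rewrite add0r.
rewrite E normrN in cB.
rewrite -(diff_inverseK (iter_diff vs k y) Vy); apply: le_trans (dkM _) _.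
exact: ler_wpM2l.
Qed.

End InverseRecursion.

Section InversionClosed.
Variables (R : realType) (m : nat -> R).
Hypothesis m_gt0 : forall n, (1 <= n)%N -> 0 < m n.

Lemma linear_row_bound n (W : normedModType R) (l : {linear 'rV[R]_n -> W}) w :
  `|l w| <= (\sum_(i < n) `|l (delta_mx 0 i)|) * `|w|.
Proof.
rewrite {1}(row_sum_delta w) linear_sum mulr_suml.
apply: le_trans (ler_norm_sum _ _ _) _; apply: ler_sum => i _.
by rewrite linearZ /= normrZ mulrC ler_wpM2l// norm_row_coord.
Qed.

(** By continuity each of the finitely many partial derivatives exceeds its norm at [y0] by at most
    1 nearby, and they bound the operator norm. *)
Lemma near_diff_bounded n (W : normedModType R) (V : set 'rV[R]_n) (k : 'rV[R]_n -> W) y0 :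
  smooth V k -> V y0 -> exists2 M : R, 0 <= M &
    \forall y \near y0, forall w, `|'d k y w| <= M * `|w|.
Proof.
move=> sk Vy0; exists (\sum_(l < n) (`|'d k y0 (delta_mx 0 l)| + 1)).
  by apply: sumr_ge0 => l _; rewrite addr_ge0.
have h : \forall y \near y0, forall l : 'I_n,
    `|'d k y (delta_mx 0 l)| <= `|'d k y0 (delta_mx 0 l)| + 1.
  apply: (@filter_forall _ _ (fun (l : 'I_n) y => `|'d k y (delta_mx 0 l)| <= `|'d k y0 (delta_mx 0 l)| + 1) (nbhs y0)) => l.
  have d : differentiable (fun y => 'd k y (delta_mx 0 l)) y0.
    exact: (sk [:: delta_mx 0 l]).
  have /cvgrPdist_le/(_ 1 ltr01) := differentiable_continuous d.
  apply: filterS => y hy; rewrite -lerBlDl.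
  by apply: le_trans (lerB_dist _ _) _; rewrite distrC.
apply: filterS h => y hy w.
apply: le_trans (linear_row_bound _ _) _; apply: ler_wpM2r => //.
by apply: ler_sum => l _; exact: hy.
Qed.

Lemma inversion_closed_majorant : geometric_majorant m -> inversion_closed m.
Proof.
move=> [C C1 hC] s U g /(classE_bounds m_gt0)[oU sg bg] _ U' V' k U'U.
move=> [[oU' oV'] [sg' sk] gU' kg].
have C0 : 0 < C by exact: lt_le_trans C1.
have kVU y : V' y -> U' (k y) by rewrite -gU' => -[x Ux <-]; rewrite kg.
have gk y : V' y -> g (k y) = y by rewrite -gU' => -[x Ux <-]; rewrite kg.
have kg' x : U' x -> V' (g x) /\ k (g x) = x.
  by move=> Ux; split; [rewrite -gU'; exists x|exact: kg].
apply: classE_intro => // y0 Vy0.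
have [Ag [Cg [rg [nAg AgU Cg0 rg0 hAg]]]] := bg _ (U'U _ (kVU _ Vy0)).
have [M M0 hM] := near_diff_bounded sk Vy0.
pose rho := rg * C; have rho0 : 0 < rho by rewrite mulr_gt0.
have sM0 : 0 <= s%:R * M by rewrite mulr_ge0.
have B0 : 0 <= s%:R * M * Cg by rewrite mulr_ge0.
have [D [K [D0 K0 hK]]] := inverse_geometric rho0 sM0 B0.
exists (V' `&` (k @^-1` Ag) `&` [set y | forall w, `|'d k y w| <= M * `|w|]), D, (K * C).
split; [|exact: ltW|by rewrite mulr_gt0|].
  apply: filterI => //; apply: filterI; first exact: open_nbhs_nbhs.
  by have /differentiable_continuous := sk [::] y0 Vy0; exact.
move=> y vs [[Vy Agk] dkM] uvs n0; set n := size vs.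
(* Dimension 0 is set apart because the end of the proof uses s >= 1 to pass from [Kf n] to
   [H n]. *)
case: (posnP s) => [s0|s_gt0].
  have -> : `|iter_diff vs k y| = 0.
    apply/eqP; rewrite eq_le normr_ge0 andbT; apply/row_norm_le => // l.
    by case: l => l ll; exfalso; move: ll; rewrite s0.
  rewrite !mulr_ge0//; try exact/ltW.
    by rewrite exprn_ge0// mulr_ge0// ltW.
  exact/ltW/m_gt0.
have [//|beta [b0 hb hn]] := hC n.
(* The majorant recursion needs one number per order. A maximum over lists with entries in [vs] is
   finite for free, and being the least bound it inherits the recursion. *)
have /choice[Kf hKf] := fun j => finite_list_sup vs j (fun ws => `|iter_diff ws k y|).
pose G j := if (j <= 1)%N then 0 else Cg * rg ^+ j * (j`!%:R * m j).
pose H j := s%:R * Kf j.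
have Kf0 j : 0 <= Kf j by have [] := hKf j.
have uws ws : all (mem vs) ws -> all (@unit_ball R _) ws.
  by move=> /allP vws; apply/allP => w /vws; have /allP := uvs; exact.
have Hrec j : (1 < j <= n)%N ->
    H j / j`!%:R <= (outer_poly n.+1 (fun i => (s%:R * M) * G i) (inner_poly j.-1 H))`_j.
  move=> /andP[j1 jn]; rewrite outer_polyZ coefZ ler_pdivrMr ?ltr0n ?fact_gt0//.
  set P := (outer_poly _ _ _)`_j.
  have P0 : 0 <= P.
    rewrite /P; have := @coef_ge0_outer R n.+1 G (inner_poly j.-1 H) _ _ j.
    rewrite coef0; apply => [i _|].
      rewrite /G; case: leqP => // i1; rewrite !mulr_ge0// ?exprn_ge0//; try exact: ltW.
      exact/ltW/m_gt0/ltnW.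
    by apply: inner_poly_ge0 => i _; rewrite mulr_ge0.
  rewrite /H -!mulrA; apply: ler_wpM2l => //.
  have [_ _ Kmin] := hKf j; apply: Kmin; first by rewrite !mulr_ge0.
  move=> ws vws szws; subst j; rewrite [P * _]mulrC /P.
  have := inverse_recursion oU' oV' sg' sk kVU gk kg' (D := mem vs) (G := G) (H := Kf) (S := n.+1) (vs := ws) Vy M0 dkM.
  apply => //.
  - move=> us uus us1; rewrite /G leqNgt us1/=; apply: hAg => //; exact: ltnW us1.
  - by move=> us vus _; have [_ + _] := hKf (size us); exact.
  - by rewrite j1 ltnS.
have szn : (n.-1).+2 = n.+1 by rewrite prednK.
have hH := hK n.-1 n beta (fun i => (s%:R * M) * G i) H b0.
rewrite szn in hH.
have : H n / n`!%:R <= D * K ^+ n * beta ^+ n.-1.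
  apply: hH => //; rewrite ?mulr0//.
  - move=> i _; rewrite mulr_ge0// /G; case: leqP => // i1.
    rewrite !mulr_ge0// ?exprn_ge0//; try exact: ltW.
    exact/ltW/m_gt0/ltnW.
  - move=> i /andP[i1 i_n]; rewrite /G leqNgt i1/= -[leRHS]mulrA -[leRHS]mulrA -[leLHS]mulrA.
    apply: ler_wpM2l => //; rewrite [leRHS]mulrA.
    apply: (geometric_bound (n := n) (C := C)) => //; try exact: ltW.
    by rewrite (ltnW i1).
  - by move=> j _; rewrite mulr_ge0.
  - rewrite /H ler_wpM2l//; have [_ _ Kmin] := hKf 1%N; apply: Kmin => // -[//|v [|//]] vv _.
    apply: le_trans (dkM _) _; rewrite -[leRHS]mulr1 ler_wpM2l//.
    by have := uws _ vv; rewrite /= andbT.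
  - by rewrite n0 leqnn.
rewrite ler_pdivrMr ?ltr0n ?fact_gt0// => Hn.
have [_ hvs _] := hKf n.
apply: le_trans (hvs vs _ _) _ => //.
apply: (@le_trans _ _ (H n)); first by rewrite /H ler_peMl// ler1n.
apply: le_trans Hn _.
rewrite exprMn [leRHS](_ : _ = D * K ^+ n * (C ^+ n * m n) * n`!%:R); last by ring.
apply: ler_wpM2r => //; apply: ler_wpM2l => //.
by rewrite mulr_ge0 ?exprn_ge0// ltW.
Qed.

End InversionClosed.

(** * Growth of log-convex weights *)

Section LogGrowth.
Variable R : realType.

(** A single term of the exponential series: a^a / a! <= e^a. *)
Lemma ln_fact_ge a : (0 < a)%N -> a%:R * ln a%:R - a%:R <= ln (a`!%:R : R).
Proof.
move=> a0; have ap : 0 < a%:R :> R by rewrite ltr0n.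
have fp : 0 < a`!%:R :> R by rewrite ltr0n fact_gt0.
have h : a%:R ^+ a / a`!%:R <= expR (a%:R : R).
  case: a a0 ap fp => // a _ ap fp.
  by apply: le_trans (expR_ge1Dxn a (ltW ap)); rewrite lerDr.
have := h; rewrite -ler_ln ?posrE ?expR_gt0 ?divr_gt0 ?exprn_gt0// expRK.
by rewrite ln_div ?posrE ?exprn_gt0// lnXn// -mulr_natl; lra.
Qed.

Lemma ln_factS_le N : ln (N.+1`!%:R : R) <= N%:R * ln N.+1%:R.
Proof.
have : (N.+1`! <= N.+1 ^ N)%N.
  elim: N => // N IH; rewrite factS expnS leq_mul2l /=.
  by apply: leq_trans IH _; case: N => // N; rewrite leq_exp2r.
rewrite -(ler_nat R) natrX => h.
rewrite -ler_ln ?posrE ?exprn_gt0 ?ltr0n ?fact_gt0// in h.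
by apply: le_trans h _; rewrite lnXn ?ltr0n// -[leLHS]mulr_natl.
Qed.

Lemma average_nondecreasing (l : nat -> R) a N :
  (forall i, l i <= l i.+1) -> (a <= N)%N ->
  N%:R * \sum_(i < a) l i <= a%:R * \sum_(i < N) l i.
Proof.
move=> l_nd /subnK <-; elim: (N - a)%N => [//|d IH].
rewrite addSn big_ord_recr /= mulrDr -natr1 mulrDl mul1r lerD//.
rewrite mulr_natl -[X in _ *+ X](card_ord a) -sumr_const.
apply: ler_sum => i _; apply: (@homo_leq _ l (fun u v => u <= v)) => //.
  by move=> ? ? ?; exact: le_trans.
by apply: leq_trans (ltnW (ltn_ord i)) _; exact: leq_addl.
Qed.

Variable m : nat -> R.
Hypothesis hm : weight m.

Let m_gt0 n : (1 <= n)%N -> 0 < m n. Proof. by case: hm => + _ _ _; apply. Qed.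

Let x n := ln (m n.+1) / n%:R.

Lemma bigM_gt0 n : 0 < bigM m n.
Proof. by case: n => // n; rewrite mulr_gt0 ?m_gt0 ?ltr0n ?fact_gt0. Qed.

Lemma mu_gt0 n : 0 < mu m n.
Proof. by rewrite divr_gt0 ?bigM_gt0. Qed.

Lemma mu_nd i j : (0 < i <= j)%N -> mu m i <= mu m j.
Proof.
move=> /andP[i0 /subnK <-]; elim: (j - i)%N => // d IH.
by apply: le_trans IH _; rewrite addSn; case: hm => _ _ + _; apply; lia.
Qed.

Lemma sum_ln_mu n : \sum_(i < n) ln (mu m i.+2) = ln n.+1`!%:R + ln (m n.+1) - ln (m 1).
Proof.
elim: n => [|n IH]; first by rewrite big_ord0 (_ : 1`!%N = 1%N)// ln1; lra.
rewrite big_ord_recr /= IH /mu /=.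
have p1 := @m_gt0 n.+1 isT; have p2 := @m_gt0 n.+2 isT.
have f1 : 0 < n.+1`!%:R :> R by rewrite ltr0n fact_gt0.
have f2 : 0 < n.+2`!%:R :> R by rewrite ltr0n fact_gt0.
rewrite ln_div ?posrE ?mulr_gt0// !lnM ?posrE//; lra.
Qed.

(* Weak log-convexity makes [(M_(n+1) / M_1)^(1/n)] nondecreasing, so
   [exp (x n) = (m (n+1))^(1/n)] can only lose a bounded factor over a doubling of [n]. *)
Lemma ln_regular : exists2 E : R, 0 <= E &
  forall a N, (0 < a)%N -> (a <= N <= 2 * a)%N -> x a <= x N + E.
Proof.
have ln3 : 0 <= ln (3 : R) by apply: ln_ge0; lra.
(* [ln 3] comes from N + 1 <= 3 a, the 1 from the lower bound a ln a - a for ln a!, and [ln (m 1)]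
   from dividing by M_1. *)
exists (`|ln (m 1)| + ln 3 + 1); first by rewrite !addr_ge0.
move=> a N a0 /andP[aN Na].
have N0 : (0 < N)%N by exact: leq_trans aN.
have ap : 0 < a%:R :> R by rewrite ltr0n.
have Np : 0 < N%:R :> R by rewrite ltr0n.
have lnd i : ln (mu m i.+2) <= ln (mu m i.+3).
  by rewrite ler_ln ?posrE ?mu_gt0//; apply: mu_nd; rewrite /= leqnSn.
have avg := average_nondecreasing lnd aN; rewrite !sum_ln_mu in avg.
have F1 := ln_factS_le N.
have F2 : a%:R * ln a%:R - a%:R <= ln (a.+1`!%:R : R).
  apply: le_trans (ln_fact_ge a0) _; rewrite ler_ln ?posrE ?ltr0n ?fact_gt0//.
  by rewrite ler_nat factS leq_pmull.
have F3 : ln (N.+1%:R : R) <= ln 3 + ln a%:R.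
  rewrite -lnM ?posrE// ler_ln ?posrE ?mulr_gt0 ?ltr0n//.
  by rewrite -natrM ler_nat; lia.
have F4 : (N%:R - a%:R) * ln (m 1) <= N%:R * `|ln (m 1)|.
  have : a%:R <= N%:R :> R by rewrite ler_nat.
  have := ler_norm (ln (m 1)); have := normr_ge0 (ln (m 1)); nra.
have F5 : 1 <= a%:R :> R by rewrite ler1n.
rewrite /x ler_pdivrMr// -(ler_pM2r Np).
set X := ln (m a.+1) in avg *; set Y := ln (m N.+1) in avg *; set Z := ln (m 1) in F4 avg *.
set A := ln (a.+1`!%:R) in F2 avg; set B := ln _ in F1 avg.
set l3 := ln 3 in F3 ln3 *; set la := ln a%:R in F2 F3; set lN := ln N.+1%:R in F1 F3.
rewrite [leRHS](_ : _ = a%:R * Y + a%:R * N%:R * `|Z| + a%:R * N%:R * l3 + a%:R * N%:R); last first.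
  by field; rewrite gt_eqF.
have G1 := ler_wpM2l (ltW ap) F1; have G2 := ler_wpM2l (ltW Np) F2.
have G3 := ler_wpM2l (mulr_ge0 (ltW ap) (ltW Np)) F3.
have G4 := ler_wpM2r (mulr_ge0 (ltW Np) (normr_ge0 Z)) F5.
by lra.
Qed.

(* Only even [T] and [r] appear: this is all that composing odd functions can
   detect, and it suffices because [M_n] is log-convex. *)
Definition odd_growth (C : R) : Prop := forall T r q,
  ~~ odd T -> ~~ odd r -> (q <= T.+1)%N ->
  m T.+1 * m r.+1 ^+ q <= C ^+ (T + q * r).+1 * m (T + q * r).+1.

Lemma odd_growth_ln C T r q : 1 <= C -> odd_growth C ->
  ~~ odd T -> ~~ odd r -> (q <= T.+1)%N ->
  ln (m T.+1) + q%:R * ln (m r.+1) <= (T + q * r).+1%:R * ln C + ln (m (T + q * r).+1).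
Proof.
move=> C1 hC oT or qT; have C0 : 0 < C by exact: lt_le_trans C1.
have := hC T r q oT or qT => h.
rewrite -ler_ln ?posrE ?mulr_gt0 ?exprn_gt0 ?m_gt0// in h.
rewrite !lnM ?posrE ?exprn_gt0 ?m_gt0// !lnXn ?m_gt0// in h.
by rewrite !mulr_natl.
Qed.

(* Split [j] copies of [r] into [t >= j / 2] copies, merged into one outer
   factor by induction, and [j - t] inner ones. *)
Lemma ln_multiples C r : 1 <= C -> odd_growth C -> (0 < r)%N -> ~~ odd r ->
  forall j, (0 < j)%N ->
  j%:R * ln (m r.+1) <= ln (m (j * r).+1) + 6 * ln C * (j * r)%:R.
Proof.
move=> C1 hC r0 or; have c0 : 0 <= ln C by exact: ln_ge0.
elim/ltn_ind => j IH j0; have [j1|j2] := leqP j 1.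
  have -> : j = 1%N by apply/eqP; rewrite eqn_leq j1.
  by rewrite !mul1n mul1r lerDl !mulr_ge0.
pose q := j./2; pose t := (j - q)%N.
have jE : (j = t + q)%N by rewrite /t /q; lia.
have q1 : (0 < q)%N by rewrite /q; lia.
have tj : (t < j)%N by lia.
have qt : (q <= t <= q.+1)%N by rewrite /t /q; lia.
have h1 := IH t tj; have h2 := @odd_growth_ln C (t * r) r q C1 hC.
have qtr : (q <= (t * r).+1)%N by nia.
have {}h1 := h1 ltac:(lia).
have {}h2 := h2 ltac:(by rewrite oddM (negbTE or) andbF) or qtr.
have E : (t * r + q * r = j * r)%N by lia.
rewrite E in h2.
(* Since t <= q + 1 and q >= 1, j is at most 3 q, so the new loss j r + 1 is covered by 6 q r, the
   part of the budget left over by the induction hypothesis. *)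
have K : (j * r).+1%:R * ln C + 6 * ln C * (t * r)%:R <= 6 * ln C * (j * r)%:R.
  have : ((j * r).+1 + 6 * (t * r) <= 6 * (j * r))%N by nia.
  rewrite -(ler_nat R) natrD !(natrM R 6).
  by move=> /(ler_wpM2l c0); lra.
have -> : j%:R = t%:R + q%:R :> R by rewrite jE natrD.
by lra.
Qed.

(** For even r, go from r to the largest multiple of r below N by [ln_multiples], then to N, which
    is less than twice as far, by [ln_regular]. An odd r < N first moves to r + 1, hence the second
    [E]. *)
Lemma almost_increasing C : 1 <= C -> odd_growth C ->
  exists2 F : R, 0 <= F & forall r N, (0 < r <= N)%N -> x r <= x N + F.
Proof.
move=> C1 hC; have c0 : 0 <= ln C by exact: ln_ge0.
have [E E0 hE] := ln_regular; exists (6 * ln C + 2 * E); first lra.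
have even r N : ~~ odd r -> (0 < r <= N)%N -> x r <= x N + 6 * ln C + E.
  move=> or /andP[r0 rN]; pose j := (N %/ r)%N.
  have j0 : (0 < j)%N by rewrite divn_gt0.
  have jN : (j * r <= N)%N by exact: leq_trunc_div.
  have Nj : (N <= 2 * (j * r))%N.
    by have := ltn_ceil N r0; rewrite -/j; nia.
  have jr0 : (0 < j * r)%N by rewrite muln_gt0 j0.
  have h1 := hE (j * r)%N N jr0; rewrite jN Nj in h1.
  have h2 := ln_multiples C1 hC r0 or j0.
  have rp : 0 < r%:R :> R by rewrite ltr0n.
  have jp : 0 < j%:R :> R by rewrite ltr0n.
  apply: (@le_trans _ _ (x (j * r)%N + 6 * ln C)); last by have := h1 isT; lra.
  rewrite /x ler_pdivrMr// -(ler_pM2l jp); apply: le_trans h2 _.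
  rewrite natrM le_eqVlt; apply/orP; left; apply/eqP; field.
  by rewrite !gt_eqF.
move=> r N /andP[r0 rN]; have [or|or] := boolP (odd r); last first.
  by have := even r N or; rewrite r0 rN => /(_ isT); lra.
have [rN'|Nr] := ltnP r N; last first.
  have -> : N = r by apply/eqP; rewrite eqn_leq Nr.
  lra.
have h1 : x r <= x r.+1 + E by apply: hE => //; lia.
have := even r.+1 N; rewrite /= or rN' => /(_ isT isT); lra.
Qed.

Lemma odd_growth_majorant C : 1 <= C -> odd_growth C -> geometric_majorant m.
Proof.
move=> C1 hC; have [F F0 hF] := almost_increasing C1 hC.
(* [expR F] compares the roots for k >= 2, [m 1] settles k = 1, and its inverse the lower bound at n
   = 1, where beta is arbitrary and taken to be 1. *)
pose K := Num.max (expR F) (Num.max (m 1) (m 1)^-1).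
have KF : expR F <= K by rewrite /K le_max lexx.
have K1 : 1 <= K by apply: le_trans KF; rewrite -expR0 ler_expR.
have Km : m 1 <= K by rewrite /K !le_max lexx orbT.
have Kv : (m 1)^-1 <= K by rewrite /K !le_max lexx !orbT.
have m1 := @m_gt0 1 isT.
have m1K : 1 <= K * m 1 by rewrite -ler_pdivrMr// div1r.
exists K => // -[//|[|N]] _.
  by exists 1; split=> // -[|[|//]] // _; rewrite expr1n mulr1 expr1.
exists (expR (x N.+1)); have mN := @m_gt0 N.+2 isT.
have E : expR (x N.+1) ^+ N.+1 = m N.+2.
  by rewrite -expRM_natl /x mulrC divfK ?pnatr_eq0// lnK.
split; first exact: expR_gt0.
- move=> [//|[|k]] /andP[_ kN]; first by rewrite expr0 mulr1 expr1.
  have mk := @m_gt0 k.+2 isT.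
  have -> : m k.+2 = expR (x k.+1) ^+ k.+1.
    by rewrite -expRM_natl /x mulrC divfK ?pnatr_eq0// lnK.
  have : expR (x k.+1) <= expR (x N.+1) * K.
    apply: (@le_trans _ _ (expR (x N.+1) * expR F)).
      by rewrite -expRD ler_expR hF.
    by rewrite ler_wpM2l// expR_ge0.
  move=> /(lerXn2r k.+1) h; apply: le_trans (h _ _) _.
  + by rewrite nnegrE expR_ge0.
  + by rewrite nnegrE mulr_ge0 ?expR_ge0//; lra.
  rewrite exprMn mulrC; apply: ler_wpM2r; first by rewrite exprn_ge0 ?expR_ge0.
  by apply: ler_weXn2l.
- rewrite E ler_peMl ?(ltW mN)//; exact: exprn_ege1.
Qed.

End LogGrowth.

(** * The characteristic function *)

Section Sine.
Variable R : realType.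

Lemma MVT_abs (f df : R -> R) (y k : R) :
  (forall x : R, is_derive x 1 f (df x)) ->
  exists2 c, `|c - y| <= `|k| & f (y + k) - f y = df c * k.
Proof.
move=> hf; have cf a b : {within `[a, b], continuous f}.
  by apply: derivable_within_continuous => x _; have [] := hf x.
have [k0|k0] := leP 0 k.
  have [|c] := MVT_segment _ (fun x _ => hf x) (cf y (y + k)); first by rewrite lerDl.
  rewrite in_itv/= => /andP[c1 c2] ->; exists c; last by rewrite addrAC subrr add0r.
  by rewrite !ger0_norm//; lra.
have [|c] := MVT_segment _ (fun x _ => hf x) (cf (y + k) y); first by rewrite gerDl ltW.
rewrite in_itv/= => /andP[c1 c2] E; exists c.
  by rewrite (ltr0_norm k0) ler0_norm; lra.
by rewrite -[LHS]opprB E; ring.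
Qed.

Lemma cos_lipschitz (u v : R) : `|cos v - cos u| <= `|v - u|.
Proof.
have [c _] := MVT_abs u (v - u) (fun x => is_derive_cos x).
rewrite subrKC => ->; rewrite normrM ler_piMl// normrN ler_norml.
by rewrite sin_geN1 sin_le1.
Qed.

Lemma sin_taylor2 (y k : R) : `|sin (y + k) - sin y - k * cos y| <= k ^+ 2.
Proof.
have [c ck ->] := MVT_abs y k (fun x => is_derive_sin x).
rewrite [k * _]mulrC -mulrBl normrM -real_normK ?num_real// expr2.
by apply: ler_wpM2r => //; apply: le_trans ck; exact: cos_lipschitz.
Qed.

(** A quadratic remainder bound survives passage to the limit, so it lets a series be differentiated
    term by term. *)
Lemma is_diff_quadratic (f : R -> R) (x a B : R) :
  (forall h, `|f (x + h) - f x - h * a| <= B * h ^+ 2) ->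
  is_diff x f (fun v => v * a).
Proof.
move=> fB; have B0 : 0 <= B by have := fB 1; rewrite expr1n mulr1; exact: le_trans.
have cv : h^-1 *: ((f \o shift x) (h *: (1 : R)) - f x) @[h --> 0^'] --> a.
  apply/cvgrPdist_le => e e0; near=> h.
  have h0 : h != 0 by near: h; exact: nbhs_dnbhs_neq.
  have hp : 0 < `|h| by rewrite normr_gt0.
  rewrite /= /shift /GRing.scale /= mulr1 [h + x]addrC.
  rewrite -(ler_pM2l hp) -normrM mulrBr [h * (h^-1 * _)]mulrA mulfV// mul1r distrC.
  apply: le_trans (fB h) _; rewrite -real_normK ?num_real// expr2 mulrCA.
  apply: ler_wpM2l => //; rewrite mulrC.
  have : `|h| <= e / (B + 1).
    near: h; apply: dnbhs0_le; rewrite divr_gt0//; lra.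
  rewrite ler_pdivlMr; [nra|lra].
have df : derivable f x 1 by apply/cvg_ex; exists a.
have Da : 'D_1 f x = a by exact: cvg_lim cv.
split; first exact/derivable1_diffP.
by rewrite deriv1E// derive1E Da.
Unshelve. all: by end_near. Qed.

End Sine.

Section CharacteristicFunction.
Variables (R : realType) (m : nat -> R).
Hypothesis hm : weight m.

Let om n : R := 2 * mu m n.+1.

Let om_gt0 n : 0 < om n. Proof. by rewrite mulr_gt0// mu_gt0. Qed.

(* [chr_fun j] is the [j]-th derivative of
   [\sum_(n >= 1) M_n / (2 mu_n)^n * sin (2 mu_n x)]; the index is shifted by one. *)
Definition chr_coef j n : R := bigM m n.+1 * om n ^+ j / om n ^+ n.+1.

Lemma bigM_recl n : bigM m n.+1 = bigM m n * mu m n.+1.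
Proof. by rewrite /mu mulrCA mulfV ?mulr1// gt_eqF// bigM_gt0. Qed.

(** The quotient of M_j and M_n is a product of |j - n| ratios mu_i, or its inverse; log-convexity
    puts these above mu_n when j > n and below it when j < n. *)
Lemma bigM_mu_le j n : (0 < n)%N ->
  bigM m n * mu m n ^+ j <= bigM m j * mu m n ^+ n.
Proof.
move=> n0; have mn := mu_gt0 hm n.
have up d : bigM m n * mu m n ^+ (n + d) <= bigM m (n + d) * mu m n ^+ n.
  elim: d => [|d IH]; first by rewrite addn0.
  rewrite addnS exprSr mulrA bigM_recl [leRHS]mulrAC.
  apply: ler_pM => //; [|exact: ltW|].
    by rewrite mulr_ge0 ?exprn_ge0// ltW// bigM_gt0.
  by apply: mu_nd => //; rewrite n0 leqW// leq_addr.
have down d : (d <= n)%N -> bigM m n * mu m n ^+ (n - d) <= bigM m (n - d) * mu m n ^+ n.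
  elim: d => [|d IH dn]; first by rewrite subn0.
  have := IH (ltnW dn); rewrite -subSS subSn// exprSr bigM_recl mulrA => h.
  rewrite -(ler_pM2r mn); apply: le_trans h _.
  rewrite [leRHS]mulrAC; apply: ler_wpM2r; first by rewrite exprn_ge0// ltW.
  apply: ler_wpM2l; first by rewrite ltW// bigM_gt0.
  by apply: mu_nd => //; rewrite ltn0Sn/=; lia.
have [nj|jn] := leqP n j; first by have := up (j - n)%N; rewrite subnKC.
by have := down (n - j)%N; rewrite subKn ?leq_subr//; [apply|exact: ltnW].
Qed.

Lemma chr_coef_gt0 j n : 0 < chr_coef j n.
Proof.
apply: divr_gt0; last exact: exprn_gt0.
by apply: mulr_gt0; [exact: bigM_gt0|exact: exprn_gt0].
Qed.

(** Frequencies mu_n alone would bound each term by M_j; doubling them adds the factor that makes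
    the series summable, while the diagonal term remains M_j. *)
Lemma chr_coef_le j n : chr_coef j n <= bigM m j * 2 ^+ j * (1 / 2) ^+ n.+1.
Proof.
rewrite /chr_coef ler_pdivrMr ?exprn_gt0// /om div1r exprVn !(exprMn _ 2).
have h := bigM_mu_le j (ltn0Sn n).
rewrite [leRHS](_ : _ = 2 ^+ j * (bigM m j * mu m n.+1 ^+ n.+1)); last first.
  by field; rewrite expf_neq0.
by rewrite mulrCA; apply: ler_wpM2l => //; exact: exprn_ge0.
Qed.

Lemma chr_coefS j n : chr_coef j.+1 n = chr_coef j n * om n.
Proof. by rewrite /chr_coef exprSr; ring. Qed.

Lemma chr_coef_diag j : (0 < j)%N -> chr_coef j j.-1 = bigM m j.
Proof. by move=> j0; rewrite /chr_coef prednK// mulfK// expf_neq0 ?gt_eqF. Qed.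

Let bnd j : R := bigM m j * 2 ^+ j.

Let bnd_ge0 j : 0 <= bnd j.
Proof. by apply: mulr_ge0; [apply/ltW/bigM_gt0|exact: exprn_ge0]. Qed.

Lemma sum_chr_coef_le j N : \sum_(0 <= n < N) chr_coef j n <= bnd j.
Proof.
rewrite big_mkord; apply: (@le_trans _ _ (\sum_(n < N) bnd j * (1 / 2) ^+ n.+1)).
  by apply: ler_sum => i _; exact: chr_coef_le.
under eq_bigr => i _ do rewrite exprS mulrA.
rewrite -mulr_sumr -[leRHS]mulr1 -mulrA ler_wpM2l//.
have : \sum_(i < N) (1 / 2 : R) ^+ i <= 2 by apply: geometric_sum_le; lra.
lra.
Qed.

(** The j-th derivative of sine, as a phase shift. *)
Definition trig j (y : R) : R := sin (y + j%:R * (pi / 2)).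

Definition chr_term j (x : R) n : R := chr_coef j n * trig j (om n * x).

Definition chr_fun j (x : R) : R := limn (series (chr_term j x)).

Lemma norm_trig j y : `|trig j y| <= 1.
Proof. by rewrite ler_norml sin_geN1 sin_le1. Qed.

Lemma trigS j y : cos (y + j%:R * (pi / 2)) = trig j.+1 y.
Proof. by rewrite /trig -(natr1 j) [(_ + 1) * _]mulrDl mul1r addrA sinDpihalf. Qed.

Lemma norm_chr_term_le j x n : `|chr_term j x n| <= chr_coef j n.
Proof.
by rewrite normrM gtr0_norm ?chr_coef_gt0// ler_piMr ?norm_trig// ltW// chr_coef_gt0.
Qed.

Lemma norm_partial_sum_le (u : nat -> R) j N : (forall n, `|u n| <= chr_coef j n) ->
  `|\sum_(0 <= n < N) u n| <= bnd j.
Proof.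
move=> uc; apply: le_trans (ler_norm_sum _ _ _) _.
by apply: le_trans (sum_chr_coef_le j N); apply: ler_sum => i _; exact: uc.
Qed.

Lemma series_chr_cvg (u : nat -> R) j : (forall n, `|u n| <= chr_coef j n) ->
  cvgn (series u).
Proof.
move=> uc; apply: normed_cvg; apply: nondecreasing_is_cvgn.
  by apply: nondecreasing_series => n _ _ /=.
exists (bnd j) => _ [N _ <-]; rewrite /series /=.
apply: le_trans (sum_chr_coef_le j N); apply: ler_sum => i _; exact: uc.
Qed.

Lemma norm_lim_le (u : nat -> R) (l B : R) :
  u n @[n --> \oo] --> l -> (forall n, `|u n| <= B) -> `|l| <= B.
Proof.
move=> ul uB; have nl : `|u n| @[n --> \oo] --> `|l| by exact: cvg_norm.
have <- : limn (fun n => `|u n|) = `|l| by apply: cvg_lim nl.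
by apply: limr_le; [apply/cvg_ex; exists `|l| | near=> n].
Unshelve. all: by end_near. Qed.

Lemma chr_fun_cvg j x : series (chr_term j x) n @[n --> \oo] --> chr_fun j x.
Proof. by apply/(@series_chr_cvg _ j); exact: norm_chr_term_le. Qed.

Lemma norm_chr_fun_le j x : `|chr_fun j x| <= bigM m j * 2 ^+ j.
Proof.
apply: (norm_lim_le (@chr_fun_cvg j x)) => N.
by apply: norm_partial_sum_le; exact: norm_chr_term_le.
Qed.

(** The Taylor remainder of the n-th term is at most [chr_coef j.+2 n * h ^+ 2], and these
    coefficients are summable uniformly in x. *)
Lemma is_diff_chr_fun j x : is_diff x (chr_fun j) (fun v => v * chr_fun j.+1 x).
Proof.
apply: (@is_diff_quadratic _ _ _ _ (bnd j.+2)) => h.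
pose u N := series (chr_term j (x + h)) N - series (chr_term j x) N -
  h * series (chr_term j.+1 x) N.
apply: (@norm_lim_le u).
  by apply: cvgB; [apply: cvgB|apply: cvgMr]; exact: chr_fun_cvg.
move=> N; rewrite /u /series /= mulr_sumr -!sumrB.
have [->|h0] := eqVneq h 0.
  rewrite expr0n mulr0 big1 ?normr0// => i _.
  by rewrite addr0 subrr mul0r subr0.
rewrite -ler_pdivrMr; last by rewrite exprn_even_gt0//= h0.
have h2 : 0 < h ^+ 2 by rewrite exprn_even_gt0//= h0.
rewrite -[X in _ / X]gtr0_norm// -normf_div mulr_suml.
apply: norm_partial_sum_le => n.
rewrite normf_div (gtr0_norm h2) ler_pdivrMr//.
set y := om n * x + j%:R * (pi / 2); set k := om n * h.
have -> : chr_term j (x + h) n - chr_term j x n - h * chr_term j.+1 x n =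
    chr_coef j n * (sin (y + k) - sin y - k * cos y).
  rewrite /chr_term -trigS chr_coefS /trig [om n * (x + h)]mulrDr [_ + om n * h + _]addrAC.
  by rewrite -/y -/k /k; ring.
have cp := chr_coef_gt0 j n.
rewrite normrM (gtr0_norm cp) [leRHS](_ : _ = chr_coef j n * k ^+ 2).
  by apply: ler_wpM2l; [exact: ltW|exact: sin_taylor2].
by rewrite !chr_coefS /k exprMn; ring.
Qed.

(** At 0 all terms share the factor [trig j 0]; what remains is a positive series whose diagonal
    term is already M_j. *)
Lemma chr_fun0 j : exists2 s, chr_fun j 0 = trig j 0 * s & ((0 < j)%N -> bigM m j <= s).
Proof.
have cc := @series_chr_cvg (chr_coef j) j; exists (limn (series (chr_coef j))).
  apply: cvg_lim => //; rewrite (_ : series _ = fun N => trig j 0 * series (chr_coef j) N).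
    by apply: cvgMr; apply: cc => n; rewrite gtr0_norm ?chr_coef_gt0.
  apply/funext => N; rewrite /series /= mulr_sumr; apply: eq_bigr => i _.
  by rewrite /chr_term mulr0 mulrC.
move=> j0; apply: limr_ge; first by apply: cc => n; rewrite gtr0_norm ?chr_coef_gt0.
exists j => // N /= jN; rewrite -(chr_coef_diag j0) /series/= big_mkord.
have jN' : (j.-1 < N)%N by rewrite prednK.
rewrite (bigD1 (Ordinal jN'))//= lerDl; apply: sumr_ge0 => i _.
exact/ltW/chr_coef_gt0.
Qed.

End CharacteristicFunction.

Section Trig.
Variable R : realType.

Lemma trigSS j (y : R) : trig j.+2 y = - trig j y.
Proof. by rewrite -trigS -(natr1 j) [(_ + 1) * _]mulrDl mul1r addrA cosDpihalf. Qed.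

Lemma trig_even j : ~~ odd j -> trig j (0 : R) = 0.
Proof.
elim/ltn_ind: j => -[|[|j]] IH //; first by rewrite /trig mul0r addr0 sin0.
by rewrite /= negbK => oj; rewrite trigSS IH ?oppr0.
Qed.

Lemma norm_trig_odd j : odd j -> `|trig j (0 : R)| = 1.
Proof.
elim/ltn_ind: j => -[|[|j]] IH //; first by rewrite /trig mul1r add0r sin_pihalf normr1.
by rewrite /= negbK => oj; rewrite trigSS normrN IH.
Qed.

(** The sine addition formula with one term killed by parity. It multiplies the sign of an inner
    derivative into that of the outer one, so all the terms of a given order share one sign. *)
Lemma trigD i j : odd i -> trig i (0 : R) * trig j.+1 0 = trig (i + j) 0.
Proof.
case: i => // i /= ei; rewrite -[trig i.+1 0]trigS /trig !add0r addSnnS natrD [(i%:R + _) * _]mulrDl sinD.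
by have := trig_even ei; rewrite /trig add0r => ->; rewrite mul0r add0r mulrC.
Qed.

End Trig.

Section ExactLeibniz.
Variable R : realType.
Implicit Types V W : normedModType R.

Lemma rcons_nseq T n (v : T) : rcons (nseq n v) v = nseq n.+1 v.
Proof. by elim: n => //= n ->. Qed.

Lemma smooth_diff V W (U : set V) (f : V -> W) v : smooth U f -> smooth U (fun y => 'd f y v).
Proof. by move=> sf vs x Ux; rewrite -iter_diff_rcons; exact: sf. Qed.

Lemma smooth_add V W (U : set V) (f g : V -> W) : open U ->
  smooth U f -> smooth U g -> smooth U (fun x => f x + g x) /\
  forall vs x, U x -> iter_diff vs (fun x => f x + g x) x = iter_diff vs f x + iter_diff vs g x.
Proof.
move=> oU /smoothP sf /smoothP sg; split.
  by apply/smoothP => n; exact: (smooth_upto_add oU (sf n) (sg n)).1.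
by move=> vs x; exact: (smooth_upto_add oU (sf (size vs)) (sg (size vs))).2.
Qed.

Lemma smooth_cst V W (U : set V) (c : W) : open U -> smooth U (fun=> c : W).
Proof. by move=> oU; apply/smoothP => n; exact: (smooth_upto_cst n c oU).1. Qed.

Lemma smooth_scale V W (U : set V) (u : V -> R) (w : V -> W) : open U ->
  smooth U u -> smooth U w -> smooth U (fun x => u x *: w x).
Proof.
by move=> oU /smoothP su /smoothP sw; apply/smoothP => n; exact: smooth_upto_scale.
Qed.

Lemma iter_diff_nseq_scale V W (U : set V) n v (u : V -> R) (w : V -> W) x :
  open U -> U x -> smooth U u -> smooth U w ->
  iter_diff (nseq n v) (fun y => u y *: w y) x =
  \sum_(k < n.+1) (iter_diff (nseq k v) u x *: iter_diff (nseq (n - k) v) w x) *+ 'C(n, k).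
Proof.
move=> oU Ux; elim: n u w => [|n IH] u w su sw; first by rewrite big_ord1.
rewrite -rcons_nseq (iter_diff_scale_rcons _ _ oU Ux su sw).
rewrite (pascal_sum (fun i j => iter_diff (nseq i v) u x *: iter_diff (nseq j v) w x)).
rewrite !IH//; try exact: smooth_diff.
by congr (_ + _); apply: eq_bigr => k _; rewrite -rcons_nseq iter_diff_rcons.
Qed.

End ExactLeibniz.

(** * Derivatives of the iterated characteristic function *)

Section ChrComposition.
Variables (R : realType) (m : nat -> R).
Hypothesis hm : weight m.
Local Notation psi := (chr_fun m).

Lemma is_diff_chr_comp (V : normedModType R) (eta : V -> R) r x :
  differentiable eta x ->
  is_diff x (psi r \o eta) (fun v => 'd eta x v *: psi r.+1 (eta x)).
Proof.
by move=> /differentiableP de; exact: is_diff_comp de (is_diff_chr_fun hm _ _).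
Qed.

Lemma smooth_chr_comp (V : normedModType R) (U : set V) (eta : V -> R) r :
  open U -> smooth U eta -> smooth U (psi r \o eta).
Proof.
move=> oU se; apply/smoothP => n; elim: n r => [|n IH] r.
  by apply/smooth_upto0 => x Ux; case: (is_diff_chr_comp r (se [::] x Ux)).
apply/smooth_uptoS; split=> [x Ux|v]; first by case: (is_diff_chr_comp r (se [::] x Ux)).
have h := smooth_upto_scale oU ((smoothP _ _).1 (smooth_diff v se) n) (IH r.+1).
apply: (eq_smooth_upto oU _ h).1 => x Ux.
by have [_ ->] := is_diff_chr_comp r (se [::] x Ux).
Qed.

(** The absolute value of the j-th derivative at 0: for odd j the denominator is its sign, and the
    even derivatives vanish. *)
Definition chr_val j : R := if odd j then psi j 0 / trig j 0 else 0.

Lemma trig_neq0 j : odd j -> trig j (0 : R) != 0.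
Proof. by move=> oj; rewrite -normr_gt0 norm_trig_odd. Qed.

Lemma psi0E j : psi j 0 = trig j 0 * chr_val j.
Proof.
rewrite /chr_val; case: ifP => oj; first by rewrite mulrC divfK// trig_neq0.
by have [s -> _] := chr_fun0 hm j; rewrite trig_even ?oj// !mul0r.
Qed.

Lemma chr_val_ge j : odd j -> bigM m j <= chr_val j.
Proof.
move=> oj; rewrite /chr_val oj; have [s -> sj] := chr_fun0 hm j.
by rewrite mulrAC mulfV ?trig_neq0// mul1r sj//; case: (j) oj.
Qed.

Lemma chr_val_ge0 j : 0 <= chr_val j.
Proof.
have [oj|ej] := boolP (odd j); last by rewrite /chr_val (negbTE ej).
exact: le_trans (ltW (bigM_gt0 hm j)) (chr_val_ge oj).
Qed.

(* All terms of Faa di Bruno's formula carry the same sign because only odd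
   derivatives of [eta] survive at [x]. *)
Lemma iter_diff_chr_comp (V : normedModType R) (U : set V) (eta : V -> R) v x S r N n :
  open U -> U x -> smooth U eta -> eta x = 0 ->
  (forall k, (0 < k)%N -> iter_diff (nseq k v) eta x = psi k 0) ->
  (n <= N)%N -> (n < S)%N ->
  iter_diff (nseq n v) (psi r \o eta) x =
  trig (r + n) 0 * fdb S (fun i => chr_val (r + i)) chr_val N n.
Proof.
move=> oU Ux se e0 ek; elim: S r n => // S IH r [|n] nN nS.
  by rewrite fdb0 addn0 /= e0 psi0E.
rewrite -rcons_nseq iter_diff_rcons.
have s1 := smooth_diff v se; have s2 := smooth_chr_comp r.+1 oU se.
have h := smooth_scale oU s1 s2.
rewrite (eq_smooth_upto oU _ ((smoothP _ _).1 h n)).2 ?size_nseq//; last first.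
  by move=> y Uy; have [_ ->] := is_diff_chr_comp r (se [::] y Uy).
rewrite (iter_diff_nseq_scale n v oU Ux s1 s2) fdbS// mulr_sumr.
apply: eq_bigr => -[k /= kn] _; rewrite mulrnAr; congr (_ *+ _).
rewrite -iter_diff_rcons rcons_nseq ek// psi0E IH//; [|lia|lia].
under [X in fdb _ X]eq_fun do rewrite addSnnS.
rewrite /GRing.scale/=; have [ok|ek'] := boolP (odd k.+1); last first.
  have -> : chr_val k.+1 = 0 by rewrite /chr_val (negbTE ek').
  by rewrite !(mulr0, mul0r).
have -> : trig (r + n.+1) 0 = trig k.+1 0 * trig (r.+1 + (n - k)) (0 : R).
  by rewrite addSn trigD//; congr trig; lia.
by ring.
Qed.

(** All terms being nonnegative, one suffices: in P^(T+1), take degree r+1 from q factors and degree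
    1 from the others, for a total of n. *)
Lemma fdb_chr_ge T r q n : ~~ odd T -> ~~ odd r -> (q <= T.+1)%N -> n = (T + q * r).+1 ->
  n`!%:R * (m T.+1 * (m r.+1 ^+ q * m 1 ^+ (T.+1 - q))) <= fdb n.+1 chr_val chr_val n n.
Proof.
move=> eT er qT nE; rewrite /fdb; apply: ler_wpM2l => //.
set P := inner_poly n chr_val.
have P0 : coef_le 0 P by apply: inner_poly_ge0 => k _; exact: chr_val_ge0.
have hv j : odd j -> m j <= chr_val j / j`!%:R.
  move=> oj; rewrite ler_pdivlMr ?ltr0n ?fact_gt0// mulrC.
  by have := chr_val_ge oj; case: (j) oj.
have Pj j : odd j -> (j <= n)%N -> coef_le (m j *: 'X^j) P.
  move=> oj jn k; rewrite coefZ coefXn; case: eqVneq => [->|_].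
    by rewrite mulr1 coef_poly ltnS jn; have := hv j oj; case: (j) oj.
  by rewrite mulr0; have := P0 k; rewrite coef0.
have m0 j : odd j -> 0 <= m j.
  by case: hm => mg _ _ _ oj; apply/ltW/mg; case: (j) oj.
have mX0 j : odd j -> coef_le 0 (m j *: 'X^j : {poly R}).
  move=> oj k; rewrite coef0 coefZ coefXn.
  by case: (_ == _); rewrite ?mulr1 ?mulr0// m0.
have c1 : (m r.+1 ^+ q * m 1 ^+ (T.+1 - q)) <= (P ^+ T.+1)`_n.
  rewrite -[in leRHS](subnKC qT) exprD.
  have k0 : odd r.+1 by [].
  have le1 : coef_le ((m r.+1 *: 'X^(r.+1)) ^+ q) (P ^+ q).
    case: (posnP q) => [->|q0]; first by rewrite !expr0 => k; exact: lexx.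
    by apply: coef_leX => //; [exact: mX0|apply: Pj => //; nia].
  have le2 : coef_le ((m 1 *: 'X^1) ^+ (T.+1 - q)) (P ^+ (T.+1 - q)).
    by apply: coef_leX => //; [exact: mX0|apply: Pj => //; lia].
  have := coef_leM (coef_ge0X q (mX0 _ k0)) (coef_ge0X (T.+1 - q) (mX0 1%N isT)) le1 le2 n.
  apply: le_trans; rewrite !exprZn -scalerAl -scalerAr scalerA -!exprM -exprD.
  rewrite coefZ coefXn (_ : n == _) ?mulr1//; apply/eqP; nia.
have t1 : odd T.+1 by [].
rewrite /outer_poly coef_sum.
have Tn : (T.+1 < n.+1)%N by nia.
rewrite (bigD1 (Ordinal Tn))//= -[leLHS]addr0; apply: lerD.
  rewrite coefZ; apply: ler_pM => //; [exact: m0| |exact: hv].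
  by rewrite mulr_ge0 ?exprn_ge0 ?m0.
apply: sumr_ge0 => i _; rewrite coefZ mulr_ge0 ?divr_ge0 ?chr_val_ge0//.
by have := coef_ge0X i P0 n; rewrite coef0.
Qed.

End ChrComposition.

(** * Necessity of the growth condition *)

Section Necessity.
Variables (R : realType) (m : nat -> R).
Hypothesis hm : weight m.
Local Notation psi := (chr_fun m).

Let m_gt0 n : (1 <= n)%N -> 0 < m n. Proof. by case: hm => + _ _ _; apply. Qed.

(** There are at most n blocks of size 1, so their factors [m 1] are absorbed by enlarging the
    constant. *)
Lemma odd_growth_normalize D : 0 < D -> (forall T r q, ~~ odd T -> ~~ odd r -> (q <= T.+1)%N ->
    m T.+1 * (m r.+1 ^+ q * m 1 ^+ (T.+1 - q)) <= D ^+ (T + q * r).+1 * m (T + q * r).+1) ->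
  exists2 C, 1 <= C & odd_growth m C.
Proof.
move=> D0 hD; pose K := Num.max 1 (m 1)^-1; pose E := Num.max 1 D.
have K1 : 1 <= K by rewrite le_max lexx.
have E1 : 1 <= E by rewrite le_max lexx.
have m1 := @m_gt0 1 isT; have KE : 1 <= E * K by exact: mulr_ege1.
exists (E * K) => // T r q eT er qT; set n := (T + q * r).+1.
have mq : 0 < m 1 ^+ (T.+1 - q) by rewrite exprn_gt0.
rewrite -(ler_pM2r mq) -mulrA; apply: le_trans (hD T r q eT er qT) _; rewrite -/n.
have mn := @m_gt0 n isT.
rewrite exprMn mulrAC; apply: ler_wpM2r; first exact: ltW.
rewrite -mulrA -[leLHS]mulr1; apply: ler_pM => //; first by rewrite exprn_ge0// ltW.
  by rewrite lerXn2r ?nnegrE ?le_max ?lexx ?orbT ?ltW//; lra.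
have : 1 <= (K * m 1) ^+ (T.+1 - q).
  by apply: exprn_ege1; rewrite -ler_pdivrMr// div1r le_max lexx orbT.
move=> /le_trans; apply; rewrite exprMn; apply: ler_wpM2r; first exact: ltW.
by apply: ler_weXn2l => //; rewrite /n; lia.
Qed.

Lemma FdB_odd_growth : FdB m -> exists2 C, 1 <= C & odd_growth m C.
Proof.
move=> [D D1 hD]; apply: (@odd_growth_normalize D); first exact: lt_le_trans D1.
move=> T r q eT er qT.
pose k (i : 'I_T.+1) := if (i < q)%N then r.+1 else 1%N.
have k1 i : (1 <= k i)%N by rewrite /k; case: ifP.
have := hD _ k isT k1.
have split_ord (M : Type) (idx : M) (op : Monoid.com_law idx) (a b : M) :
    \big[op/idx]_(i < T.+1) (if (i < q)%N then a else b) =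
    op (\big[op/idx]_(i < q) a) (\big[op/idx]_(i < T.+1 - q) b).
  rewrite -(big_mkord xpredT (fun i => if (i < q)%N then a else b)).
  rewrite (big_cat_nat (n := q))//=; congr (op _ _).
    by rewrite big_mkord; apply: eq_bigr => i _; rewrite ltn_ord.
  rewrite -{1}[q]add0n big_addn big_mkord; apply: eq_bigr => i _.
  by rewrite ltnNge leq_addl.
have -> : (\sum_(i < T.+1) k i = (T + q * r).+1)%N.
  rewrite split_ord !big_const_ord !iter_addn_0 /=; nia.
have -> : \prod_(i < T.+1) m (k i) = m r.+1 ^+ q * m 1 ^+ (T.+1 - q).
  under eq_bigr => i _ do rewrite /k (fun_if m).
  by rewrite split_ord !big_const_ord !iter_mulr_1.
move=> h; exact: h.
Qed.

(** The common end of the composition and inversion cases: only derivatives at 0 along one direction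
    [v] matter, where [eta] imitates psi and one coordinate of [f] imitates psi o eta. *)
Lemma class_odd_growth s t (U : set 'rV[R]_s) (f : 'rV[R]_s -> 'rV[R]_t) eta v l :
  classE m U f -> U 0 -> `|v| <= 1 -> smooth setT eta -> eta 0 = 0 ->
  (forall k, (0 < k)%N -> iter_diff (nseq k v) eta 0 = psi k 0) ->
  (forall k, (0 < k)%N -> iter_diff (nseq k v) f 0 0 l = iter_diff (nseq k v) (psi 0 \o eta) 0) ->
  exists2 C, 1 <= C & odd_growth m C.
Proof.
move=> /(classE_bounds m_gt0)[oU sf bf] U0 v1 se e0 ek fe.
have [A [C [rho [nA AU C0 rho0 bA]]]] := bf 0 U0.
have A0 : A 0 by exact: nbhs_singleton nA.
pose D := (1 + C) * rho; have D0 : 0 < D by rewrite mulr_gt0//; lra.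
apply: (@odd_growth_normalize D) => // T r q eT er qT.
set n := (T + q * r).+1; have fn : 0 < n`!%:R :> R by rewrite ltr0n fact_gt0.
rewrite -(ler_pM2l fn).
apply: le_trans (fdb_chr_ge hm eT er qT (erefl n)) _.
have on : odd n by rewrite /n /= oddD (negbTE eT) oddM (negbTE er) andbF.
have uv : all (@unit_ball R _) (nseq n v) by rewrite all_nseq; apply/orP; right.
have := bA 0 _ A0 uv; rewrite size_nseq => /(_ isT) h.
have := @iter_diff_chr_comp R m hm _ setT eta v 0 n.+1 0 n n openT I se e0 ek (leqnn n) (ltnSn n).
rewrite add0n -fe// => E.
have : `|iter_diff (nseq n v) f 0 0 l| <= C * rho ^+ n * (n`!%:R * m n).
  exact: le_trans (norm_row_coord _ _) h.
rewrite E normrM norm_trig_odd// mul1r => /(le_trans (ler_norm _)) /le_trans; apply.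
have mn := @m_gt0 n isT.
rewrite mulrCA -mulrA /D; apply: ler_wpM2l; first exact: ltW.
rewrite mulrA; apply: ler_wpM2r; first exact: ltW.
rewrite exprMn; apply: ler_wpM2r; first by rewrite exprn_ge0// ltW.
apply: (@le_trans _ _ (1 + C)); first lra.
by rewrite -[leLHS]expr1; apply: ler_weXn2l => //; lra.
Qed.

Lemma smooth_chr_lift s (W : normedModType R) (i : 'I_s) (e : W) :
  smooth setT (fun p : 'rV[R]_s => psi 0 (p 0 i) *: e) /\
  forall vs p, iter_diff vs (fun p : 'rV[R]_s => psi 0 (p 0 i) *: e) p =
    (\prod_(v <- vs) (v 0 i : R) * psi (size vs) (p 0 i)) *: e.
Proof.
pose F (vs : seq 'rV[R]_s) (p : 'rV[R]_s) : W := (\prod_(v <- vs) (v 0 i : R) * psi (size vs) (p 0 i)) *: e.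
have dF vs p : is_diff p (F vs) (fun v => F (v :: vs) p).
  have dc : differentiable (row_coord i) p.
    by case: (is_diff_linear p (@continuous_row_coord R _ i)).
  have [_ dcE] := is_diff_linear p (@continuous_row_coord R _ i).
  have d1 := is_diff_chr_comp hm (size vs) dc.
  have d2 := is_diffZf d1 (is_diff_cst (\prod_(v <- vs) (v 0 i : R) *: e) p).
  have -> : F vs = (fun y => (psi (size vs) \o row_coord i) y *:
      cst (\prod_(v <- vs) (v 0 i : R) *: e) y).
    by apply/funext => y; rewrite /F /= scalerA mulrC.
  apply: (is_diff_eq d2); apply/funext => v.
  by rewrite /F big_cons scaler0 add0r dcE !scalerA; congr (_ *: _); rewrite /GRing.scale/= /row_coord; ring.
have h n := @iter_diff_unique R _ _ n setT F (fun p : 'rV[R]_s => psi 0 (p 0 i) *: e) openT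
  (fun p _ => ltac:(by rewrite /F big_nil mul1r)) (fun vs p _ _ => dF vs p).
split; first by apply/smoothP => n; exact: (h n).1.
by move=> vs p; apply: (h (size vs)).2.
Qed.

Lemma chr_lift_bound s (W : normedModType R) (i : 'I_s) (e : W) vs p :
  `|e| <= 1 -> all (@unit_ball R 'rV[R]_s) vs ->
  `|iter_diff vs (fun p : 'rV[R]_s => psi 0 (p 0 i) *: e) p| <= bigM m (size vs) * 2 ^+ size vs.
Proof.
move=> e1 uvs; rewrite (smooth_chr_lift i e).2 normrZ normrM.
have P1 : `|\prod_(v <- vs) (v 0 i : R)| <= 1.
  rewrite normr_prod; elim: vs uvs => [|v vs IH]; first by rewrite big_nil.
  move=> /andP[v1 /IH h]; rewrite big_cons mulr_ile1 ?prodr_ge0//.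
  exact: le_trans (norm_row_coord _ _) v1.
have := norm_chr_fun_le hm (size vs) (p 0 i); set B := bigM _ _ * _ => hB.
apply: le_trans hB; rewrite -[leRHS]mulr1; apply: ler_pM => //.
by rewrite ler_piMl.
Qed.

Lemma classE_chr_lift s (W : normedModType R) (i : 'I_s) (e : W) :
  `|e| <= 1 -> classE m setT (fun p : 'rV[R]_s => psi 0 (p 0 i) *: e).
Proof.
move=> e1; apply: classE_intro => //; [exact: openT|exact: (smooth_chr_lift i e).1|].
move=> x0 _; exists setT, 1, 2; split=> //; first exact: filterT.
move=> x vs _ uvs n0; apply: le_trans (chr_lift_bound i x e1 uvs) _.
by rewrite mul1r mulrC; case: (size vs) n0.
Qed.

Lemma psi00 : psi 0 0 = 0.
Proof. by rewrite psi0E// /chr_val mulr0. Qed.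

Lemma smooth_psi_coord s (i : 'I_s) : smooth setT (psi 0 \o row_coord i : 'rV[R]_s -> R).
Proof.
have [+ _] := smooth_chr_lift i (1 : R).
rewrite (_ : (fun p : 'rV[R]_s => _) = psi 0 \o row_coord i)//.
by apply/funext => p; exact: mulr1.
Qed.

Lemma iter_diff_psi_coord s (i : 'I_s) (v : 'rV[R]_s) k : v 0 i = 1 ->
  iter_diff (nseq k v) (psi 0 \o row_coord i) 0 = psi k 0.
Proof.
move=> vi; have [_ +] := smooth_chr_lift i (1 : R).
rewrite (_ : (fun p : 'rV[R]_s => _) = psi 0 \o row_coord i); last first.
  by apply/funext => p; exact: mulr1.
move=> ->; rewrite big1_seq; last by move=> w /andP[_ /nseqP[-> _]].
by rewrite size_nseq mul1r mxE /GRing.scale/= mulr1.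
Qed.

Lemma composition_closed_odd_growth :
  composition_closed m -> exists2 C, 1 <= C & odd_growth m C.
Proof.
move=> cc; pose e : 'rV[R]_1 := delta_mx 0 0.
pose g (p : 'rV[R]_1) := psi 0 (p 0 0) *: e.
have eg : classE m setT g by apply: classE_chr_lift; exact: norm_delta_mx.
have fd : finite_dim 'rV[R]_1.
  by exists 1%N, (fun i => delta_mx 0 i) => w; exists (fun i => w 0 i); exact: row_sum_delta.
have egg : classE m setT (g \o g) := cc 1 1 _ fd setT setT g g eg eg (fun _ _ => I).
have e00 : e 0 0 = 1 by rewrite mxE.
have E : (fun p => (g \o g) p 0 0) = psi 0 \o (psi 0 \o row_coord 0).
  by apply/funext => p; rewrite /= /g !mxE !mulr1.
apply: (@class_odd_growth 1 1 setT (g \o g) (psi 0 \o row_coord 0) e 0 egg) => //.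
- exact: norm_delta_mx.
- exact: smooth_psi_coord.
- by rewrite /= linear0 psi00.
- by move=> k _; exact: iter_diff_psi_coord.
- move=> k _; rewrite -E; case: egg => _ /smoothP sgg _.
  by rewrite (smooth_upto_coord 0 openT (sgg (size (nseq k e)))).2.
Qed.

(** * The shear and its inverse *)

Section Shear.
Let i0 : 'I_3 := Ordinal (isT : (0 < 3)%N).
Let i1 : 'I_3 := Ordinal (isT : (1 < 3)%N).
Let i2 : 'I_3 := Ordinal (isT : (2 < 3)%N).
Let e (i : 'I_3) : 'rV[R]_3 := delta_mx 0 i.

Let eta (q : 'rV[R]_3) : R := q 0 i1 + psi 0 (q 0 i0).

(* The third coordinate of the inverse [unshear] along the first axis is
   [psi 0 \o psi 0]. *)
Definition shear (p : 'rV[R]_3) : 'rV[R]_3 :=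
  p + (psi 0 (p 0 i0) *: - e i1 + psi 0 (p 0 i1) *: - e i2).

Definition unshear (q : 'rV[R]_3) : 'rV[R]_3 :=
  q + (psi 0 (q 0 i0) *: e i1 + psi 0 (eta q) *: e i2).

Lemma shearE p : [/\ shear p 0 i0 = p 0 i0, shear p 0 i1 = p 0 i1 - psi 0 (p 0 i0) &
  shear p 0 i2 = p 0 i2 - psi 0 (p 0 i1)].
Proof. by split; rewrite !mxE /=; ring. Qed.

Lemma unshearE q : [/\ unshear q 0 i0 = q 0 i0, unshear q 0 i1 = eta q &
  unshear q 0 i2 = q 0 i2 + psi 0 (eta q)].
Proof. by split; rewrite !mxE /= /eta; ring. Qed.

Lemma row3P (p q : 'rV[R]_3) :
  p 0 i0 = q 0 i0 -> p 0 i1 = q 0 i1 -> p 0 i2 = q 0 i2 -> p = q.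
Proof.
move=> h0 h1 h2; apply/rowP => -[[|[|[|//]]] h].
- by rewrite (_ : Ordinal h = i0)//; exact: val_inj.
- by rewrite (_ : Ordinal h = i1)//; exact: val_inj.
- by rewrite (_ : Ordinal h = i2)//; exact: val_inj.
Qed.

Lemma shearK : cancel shear unshear.
Proof.
move=> p; have [s0 s1 s2] := shearE p; have [u0 u1 u2] := unshearE (shear p).
by apply: row3P; rewrite ?u0 ?u1 ?u2 /eta ?s0 ?s1 ?s2 ?subrK.
Qed.

Lemma unshearK : cancel unshear shear.
Proof.
move=> q; have [s0 s1 s2] := shearE (unshear q); have [u0 u1 u2] := unshearE q.
by apply: row3P; rewrite ?s0 ?s1 ?s2 ?u0 ?u1 ?u2 /eta ?addrK.
Qed.

Let idl : {linear 'rV[R]_3 -> 'rV[R]_3} := idfun.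

Let idl_continuous : continuous idl. Proof. by move=> x; exact: cvg_id. Qed.

Lemma smooth_id3 : smooth setT (fun p : 'rV[R]_3 => p) /\
  forall vs p, iter_diff vs (fun p : 'rV[R]_3 => p) p =
    match vs with [::] => p | [:: v] => v | _ => 0 end.
Proof.
have [] := smooth_affine 0 (openT : open (setT : set 'rV[R]_3)) idl_continuous.
rewrite (_ : (fun x => idl x + 0) = id); last by apply/funext => x; rewrite addr0.
by move=> s1 s2; split=> // vs p; rewrite s2//; case: vs => //=; rewrite addr0.
Qed.

Lemma smooth_eta : smooth setT eta /\ forall vs q,
  iter_diff vs eta q = iter_diff vs (row_coord i1) q + iter_diff vs (psi 0 \o row_coord i0) q.
Proof.
have sc : smooth setT (row_coord i1 : 'rV[R]_3 -> R).
  apply/smoothP => n.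
  exact: (smooth_upto_coord i1 openT ((smoothP _ _).1 smooth_id3.1 n)).1.
have [s1 s2] := smooth_add openT sc (smooth_psi_coord i0).
by split=> // vs q; exact: s2.
Qed.

Lemma iter_diff_row_coord (i : 'I_3) vs q : (0 < size vs)%N ->
  all (fun v : 'rV[R]_3 => v 0 i == 0) vs -> iter_diff vs (row_coord i) q = 0.
Proof.
move=> n0 vs0.
have := (smooth_upto_coord i openT ((smoothP _ _).1 smooth_id3.1 (size vs))).2 vs q.
move=> /(_ (leqnSn _) I) ->; rewrite smooth_id3.2.
by case: vs n0 vs0 => [//|v [|w vs]] _ /=; [rewrite andbT => /eqP|rewrite mxE].
Qed.

Lemma smooth_unshear : smooth setT unshear.
Proof.
have s1 := smooth_scale openT (smooth_psi_coord i0) (smooth_cst (e i1) openT).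
have s2 := smooth_scale openT (smooth_chr_comp hm 0 openT smooth_eta.1) (smooth_cst (e i2) openT).
exact: (smooth_add openT smooth_id3.1 (smooth_add openT s1 s2).1).1.
Qed.

Lemma classE_shear : classE m setT shear.
Proof.
have [s1 d1] := smooth_chr_lift i0 (- e i1).
have [s2 d2] := smooth_chr_lift i1 (- e i2).
have [s3 d3] := smooth_add openT s1 s2.
have [s4 d4] := smooth_add openT smooth_id3.1 s3.
apply: classE_intro => //; first exact: openT.
have m1 := @m_gt0 1 isT; have m1V : 0 < (m 1)^-1 by rewrite invr_gt0.
(* The two psi terms cost 1 each; the identity contributes at order 1 only, where the inverse of
   [m 1] compensates the weight. *)
move=> x0 _; exists setT, (2 + (m 1)^-1), 2; split=> //; first exact: filterT.
  lra.
move=> x vs _ uvs n0; rewrite [iter_diff _ _ _]d4// d3//.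
have h1 := @chr_lift_bound _ _ i0 (- e i1) vs x.
have h2 := @chr_lift_bound _ _ i1 (- e i2) vs x.
rewrite !normrN in h1 h2.
have {}h1 := h1 (norm_delta_mx R _) uvs; have {}h2 := h2 (norm_delta_mx R _) uvs.
set n := size vs in h1 h2 n0 *.
have bE : bigM m n = n`!%:R * m n by case: (n) n0.
rewrite bE in h1 h2; set B := n`!%:R * m n in h1 h2 *.
have h0 : `|iter_diff vs (fun p : 'rV[R]_3 => p) x| <= (m 1)^-1 * (B * 2 ^+ n).
  have B0 : 0 <= (m 1)^-1 * (B * 2 ^+ n).
    by rewrite mulr_ge0 ?mulr_ge0 ?exprn_ge0// ltW// m_gt0.
  move: n0 uvs B0; rewrite smooth_id3.2 /B /n; case: (vs) => [//|v [|w ws]] _ uv B0.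
    rewrite [leRHS](_ : _ = 2); last first.
      by rewrite /= (_ : 1`!%N = 1%N)//; field; rewrite gt_eqF.
    by move: uv; rewrite /= andbT => /le_trans; apply; lra.
  by rewrite normr0.
apply: le_trans (ler_normD _ _) _; apply: le_trans (lerD h0 (ler_normD _ _)) _.
apply: le_trans (lerD (lexx _) (lerD h1 h2)) _.
by lra.
Qed.

Lemma shear_diffeo : diffeo_with_inverse setT setT shear unshear.
Proof.
split; [by split; exact: openT| |by apply/seteqP; split => // q _; exists (unshear q) => //; exact: unshearK|].
  by split; [case: classE_shear|exact: smooth_unshear].
by move=> x _; exact: shearK.
Qed.

Lemma inversion_closed_odd_growth :
  inversion_closed m -> exists2 C, 1 <= C & odd_growth m C.
Proof.
move=> ic; have ld : local_diffeo setT shear.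
  by move=> x _; exists setT, setT, unshear; split=> //; exact: shear_diffeo.
have ck := ic 3 setT shear classE_shear ld setT setT unshear (fun _ _ => I) shear_diffeo.
have e00 : e i0 0 i0 = 1 by rewrite mxE.
apply: (@class_odd_growth 3 3 setT unshear eta (e i0) i2 ck) => //.
- exact: norm_delta_mx.
- exact: smooth_eta.1.
- by rewrite /eta !mxE psi00 addr0.
(* Along the first axis the coordinate part of [eta] is constant, so only psi contributes. *)
- move=> k k0; rewrite smooth_eta.2 iter_diff_row_coord ?size_nseq//; last first.
    by rewrite all_nseq /= mxE /= eqxx orbT.
  by rewrite add0r; exact: iter_diff_psi_coord.
- move=> k k0; set vs := nseq k (e i0).
  have h := (smooth_upto_coord i2 openT ((smoothP _ _).1 smooth_unshear (size vs))).2 vs 0 (leqnSn _) I.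
  rewrite -h.
  have sc : smooth setT (row_coord i2 : 'rV[R]_3 -> R).
    apply/smoothP => n.
    exact: (smooth_upto_coord i2 openT ((smoothP _ _).1 smooth_id3.1 n)).1.
  have [_ s2] := smooth_add openT sc (smooth_chr_comp hm 0 openT smooth_eta.1).
  rewrite (_ : (fun y => unshear y 0 i2) = fun q => row_coord i2 q + (psi 0 \o eta) q); last first.
    by apply/funext => q; have [_ _ ->] := unshearE q.
  rewrite s2// iter_diff_row_coord ?add0r ?size_nseq//.
  by rewrite all_nseq /= mxE /= eqxx orbT.
Qed.

End Shear.

End Necessity.

Theorem theorem11 (R : realType) (m : nat -> R) (hm : weight m) :
  (FdB m <-> composition_closed m) /\
  (composition_closed m <-> inversion_closed m).
Proof.
have m_gt0 n : (1 <= n)%N -> 0 < m n by case: hm => + _ _ _; apply.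
have AI_of (P : Prop) : (P -> exists2 C, 1 <= C & odd_growth m C) -> P -> geometric_majorant m.
  by move=> h /h[C C1 hC]; exact: odd_growth_majorant hC.
have FA := AI_of _ (FdB_odd_growth hm).
have CA := AI_of _ (composition_closed_odd_growth hm).
have IA := AI_of _ (inversion_closed_odd_growth hm).
split; [split=> [/FA|/CA]|split=> [/CA|/IA]].
- exact: composition_closed_majorant.
- exact: geometric_majorant_FdB.
- exact: inversion_closed_majorant.
- exact: composition_closed_majorant.
Qed.
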